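(* Suppose that the smooth strong solution curves $(r_D^S,\pm\theta_D^S)$, $D>0$ (defined in the context), are global minimizers of $T$ over $\mathcal{A}_0$, i.e. each of them minimizes $T$ among all curves of $\mathcal{A}_0$ with the same endpoints. Let $\epsilon\in(0,1)$ and let $(r,\pi)$ be polar coordinates of a point with $\epsilon\le r\le1$. Then a minimizer of $T$ over the curves in $\mathcal{A}_\epsilon$ that terminate at $(r,\pi)$ leaves the obstacle (the circle of radius $\epsilon$ centered at the origin) at a tangent.
   Context: Admissible curves: for a terminal point $B$, $\mathcal{A}_0=\{\alpha\in AC([0,1];\mathbb{R}^2):\alpha(0)=(1,0),\ \alpha(1)=B,\ |\alpha(s)|\le1\ \forall s\}$ ($AC$ = absolutely continuous). For $\epsilon\in(0,1)$, $\mathcal{A}_\epsilon=\{\alpha\in\mathcal{A}_0: |\alpha(s)|\ge\epsilon\ \forall s\in[0,1]\}$. A pair $(r,\theta)$ of functions stands for the curve $\alpha(s)=(r(s)\cos\theta(s),r(s)\sin\theta(s))$. The time of flight (inverse-square gravitational field centered at the origin) is $$T[\alpha]=\int_0^1\frac{|\alpha'(s)|}{\sqrt{|\alpha(s)|^{-1}-1}}\,ds,\qquad\text{i.e. in polar form } T[r,\theta]=\int_0^1\sqrt{\frac{r'(s)^2+r(s)^2\theta'(s)^2}{r(s)^{-1}-1}}\,ds.$$ Strong solution curves: for $D>0$ let $r_c(D)\in(0,1)$ be the unique root in $(0,1)$ of $r^3+2Dr-2D=0$. Define $$r_D^S(s)=\begin{cases}2(r_c(D)-1)s+1, & 0\le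 s\le \tfrac12,\\ 2(1-r_c(D))(s-1)+1, & \tfrac12<s\le 1,\end{cases}$$ and, with $f_D(u)=\sqrt{\dfrac{2(1-u)D}{u^5-2u^2D(1-u)}}$ for $u\in(r_c(D),1]$, $$\theta_D^S(s)=\begin{cases}\displaystyle\int_{r_D^S(s)}^1 f_D(u)\,du, & 0\le s\le\tfrac12,\\[2mm] \displaystyle\theta_D^S(1/2)+\int_{r_c(D)}^{r_D^S(s)}f_D(u)\,du, & \tfrac12\le s\le1.\end{cases}$$ ''Leaves the obstacle at a tangent'' means that at the last point of the curve lying on the circle of radius $\epsilon$, the arc by which the curve departs from the circle is tangent to the circle. *)

(* Defs.v *)
From HB Require Import structures.
From mathcomp Require Import all_boot all_order all_algebra.
From mathcomp Require Import all_classical all_reals all_analysis.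
From mathcomp Require Import ring lra.
Import Order.TTheory GRing.Theory Num.Theory.
Import numFieldNormedType.Exports.

Set Implicit Arguments.
Unset Strict Implicit.
Unset Printing Implicit Defensive.

Local Open Scope classical_set_scope.
Local Open Scope ring_scope.

Section plane.
Context {R : realType}.
Implicit Types (p q : R * R) (a : R -> R * R).

Definition dot p q : R := p.1 * q.1 + p.2 * q.2.

(* The library norm on R * R is the sup norm; its topology is the usual one. *)
Definition enorm p : R := Num.sqrt (dot p p).

Definition polar (r t : R) : R * R := (r * cos t, r * sin t).

(* Only the restriction of a curve to [0, 1] is meaningful. *)
Definition abs_continuous01 a : Prop :=
  forall e : R, 0 < e -> exists2 d : R, 0 < d &
    forall (n : nat) (u v : 'I_n -> R),
      (forall i, [/\ 0 <= u i, u i <= v i & v i <= 1]) ->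
      trivIset setT (fun i => `]u i, v i[%classic) ->
      \sum_(i < n) (v i - u i) < d ->
      \sum_(i < n) enorm (a (v i) - a (u i)) < e.

Definition velocity a (s : R) : R * R :=
  ((fst \o a)^`()%classic s, (snd \o a)^`()%classic s).

(* Extended-real arithmetic gives the singular values their usual meaning:
   the integrand is 0 where |a| = 0; where |a| = 1 it is +oo if the velocity
   is nonzero and 0 (as 0 * +oo = 0) otherwise. *)
Definition time_of_flight a : \bar R :=
  (\int[lebesgue_measure]_(s in `[0%R, 1%R])
     ((enorm (velocity a s))%:E / sqrte ((enorm (a s))%:E^-1 - 1)))%E.

Definition admissible (B : R * R) : set (R -> R * R) :=
  [set a | [/\ abs_continuous01 a, a 0 = (1, 0), a 1 = B &
               forall s, 0 <= s <= 1 -> enorm (a s) <= 1]].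

Definition admissible_off (eps : R) (B : R * R) : set (R -> R * R) :=
  [set a | admissible B a /\ forall s, 0 <= s <= 1 -> eps <= enorm (a s)].

Definition minimizer (A : set (R -> R * R)) a : Prop :=
  A a /\ forall b, A b -> (time_of_flight a <= time_of_flight b)%E.

Definition last_contact (eps : R) a (s0 : R) : Prop :=
  [/\ 0 <= s0 <= 1, enorm (a s0) = eps &
      forall s, s0 < s <= 1 -> enorm (a s) != eps].

(* The arc leaving a s0 has a one-sided tangent there (limit of the secant
   directions, so independent of the parametrization), orthogonal to the
   radius of the circle centered at the origin through a s0. *)
Definition departs_tangentially a (s0 : R) : Prop :=
  exists t : R * R, [/\ enorm t = 1, dot t (a s0) = 0 &
    (enorm (a s - a s0))^-1 *: (a s - a s0) @[s --> s0^'+] --> t].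

(* If the curve ends on the circle (s0 = 1), there is no departing arc. *)
Definition leaves_at_tangent (eps : R) a : Prop :=
  exists s0, last_contact eps a s0 /\ (s0 < 1 -> departs_tangentially a s0).

End plane.

Section strong_solutions.
Context {R : realType}.
Implicit Types D s u : R.

Definition strong_rc D : R :=
  get [set r : R | 0 < r < 1 /\ r ^+ 3 + 2 * D * r - 2 * D = 0].

Lemma strong_rcP D : 0 < D ->
  [/\ 0 < strong_rc D < 1,
      strong_rc D ^+ 3 + 2 * D * strong_rc D - 2 * D = 0 &
      forall r : R, 0 < r < 1 -> r ^+ 3 + 2 * D * r - 2 * D = 0 ->
        r = strong_rc D].
Proof.
move=> D0.
pose f (r : R) := r ^+ 3 + 2 * D * r - 2 * D.
have uniq (x y : R) : 0 < x < 1 -> 0 < y < 1 -> f x = 0 -> f y = 0 -> x = y.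
  rewrite /f => /andP[x0 x1] /andP[y0 y1] fx fy.
  have : (x - y) * (x ^+ 2 + x * y + y ^+ 2 + 2 * D) = 0.
    by rewrite -[RHS](subr0 0) -{1}fx -fy; ring.
  move/eqP; rewrite mulf_eq0 => /orP[/eqP|/eqP]; first by lra.
  by nra.
have [r [r01 fr]] : exists r : R, 0 < r < 1 /\ f r = 0.
  have cf : {within `[0, 1], continuous f}.
    apply: continuous_subspaceT => x; rewrite /f.
    apply: cvgB; last exact: cvg_cst.
    apply: cvgD; first exact: exprn_continuous.
    by apply: cvgM; [exact: cvg_cst|exact: cvg_id].
  have [|c] := @IVT R f 0 1 0 ler01 cf.
    by rewrite /f !expr0n/= !expr1n ge_min le_max; apply/andP; split;
       apply/orP; [left|right]; lra.
  rewrite in_itv/= => /andP[c0 c1] fc; exists c; split=> //.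
  apply/andP; split; rewrite lt_neqAle ?c0 ?c1 andbT.
    by apply/eqP => c_0; move: fc; rewrite /f -c_0 expr0n/=; lra.
  by apply/eqP => c_1; move: fc; rewrite /f c_1 expr1n; lra.
have [rc01 rcE] := @getPex _ [set r : R | 0 < r < 1 /\ f r = 0]
  (ex_intro _ r (conj r01 fr)).
by split=> // x x01 fx; exact: uniq.
Qed.

Definition strong_f D u : R :=
  Num.sqrt (2 * (1 - u) * D / (u ^+ 5 - 2 * u ^+ 2 * D * (1 - u))).

Definition strong_r D s : R :=
  if s <= 2^-1 then 2 * (strong_rc D - 1) * s + 1
  else 2 * (1 - strong_rc D) * (s - 1) + 1.

(* The integrals are over half-open intervals because strong_f D is only
   meant on ]strong_rc D, 1], with an integrable singularity at strong_rc D. *)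
Definition strong_theta D s : R :=
  let half x := \int[lebesgue_measure]_(u in `]strong_r D x, 1]) strong_f D u in
  if s <= 2^-1 then half s
  else half 2^-1 +
    \int[lebesgue_measure]_(u in `]strong_rc D, strong_r D s]) strong_f D u.

Definition strong_curve D s : R * R :=
  polar (strong_r D s) (strong_theta D s).

Definition strong_curve_neg D s : R * R :=
  polar (strong_r D s) (- strong_theta D s).

End strong_solutions.

(* Main.v *)
From HB Require Import structures.
Require Import Defs.
From mathcomp Require Import all_boot all_order all_algebra.
From mathcomp Require Import all_classical all_reals all_analysis.
From mathcomp Require Import measurable_realfun ring lra.
Import Order.TTheory GRing.Theory Num.Theory.
Import numFieldNormedType.Exports.
Local Open Scope classical_set_scope.
Local Open Scope ring_scope.
Set Implicit Arguments.
Unset Strict Implicit.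
Unset Printing Implicit Defensive.

(** Write v = sqrt (1/r - 1) for the speed at distance r from the origin, so
    that T weighs the length element by the slowness 1/v. The slowness increases
    with r: it pays to be short and to be close to the obstacle. Two comparisons
    use this.

    A minimizer touches the obstacle ([contact_exists]). If its least distance m
    to the origin exceeds eps, the map (x, y) |-> (x, (eps / m) y) fixes both end
    points, which lie on the horizontal axis, keeps the curve outside the
    obstacle, and decreases speeds and radii. The decrease is strict, because
    the curve passes from the right to the left of the origin and therefore
    leaves the horizontal axis. Being closed, the set of contacts has a last
    element s0.

    There is no corner at the last contact p ([secant_not_outward]). Suppose that
    the unit secant from p to a later point at small distance delta has an
    outward component of at least beta > 0, and let u be an earlier point at the
    same distance from p. As u is not inside the disk, the angle at p between the
    two points is bounded away from a straight angle, so the chord joining them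
    is shorter than 2 delta by a factor that depends on beta only. The slowness
    on the chord exceeds that on the circle, which is the least possible one,
    by a factor 1 + O (delta) only, and the chord avoids the disk. Hence for small
    delta the chord is faster ([chord_faster_than_corner], [chord_inequality]).
    So the outward component of the secants has upper limit at most 0; it has
    lower limit at least 0 because the curve is outside the disk. The tangential
    component then has modulus tending to 1 and, by the intermediate value
    theorem, a constant sign ([tangential_departure]).

    The time of an arc is bounded from below through its chord, so the chord of
    an absolutely continuous curve must be at most the integral of the speed
    ([chord_le_length]). This is Lebesgue's theorem ([ac_line_FTC]): an
    absolutely continuous function is a difference of two nondecreasing ones,
    the Stieltjes measure of each of which is dominated by the Lebesgue
    measure, and the Radon-Nikodym density is the derivative almost
    everywhere. *)

(** * Absolutely continuous functions on the line *)

Section dominated.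
Context {R : realType}.
Notation mu := (@lebesgue_measure R).

(** Stated on the whole line, so that no end points have to be handled; a
    function on the unit interval is brought here by extending it by constants
    ([clamp01]). The index is an arbitrary finite type because families of
    families have to be flattened ([ac_line_variation]). *)
Definition ac_line (f : R -> R) : Prop :=
  forall e : R, 0 < e -> exists2 d : R, 0 < d &
    forall (T : finType) (u v : T -> R),
      (forall i, u i <= v i) ->
      trivIset setT (fun i => `]u i, v i[%classic) ->
      \sum_i (v i - u i) < d -> \sum_i `|f (v i) - f (u i)| < e.

(** For k < 2n 2^n these are the cells of mesh 2^-n of ]-n, n]. They are
    half-open because that is where Stieltjes measures are increments. *)
Definition dyadic (n : nat) (k : nat) : set R :=
  `](k%:R / 2 ^+ n - n%:R), (k.+1%:R / 2 ^+ n - n%:R)]%classic.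

Lemma dyadic_trivIset n : trivIset setT (dyadic n).
Proof.
apply: ltn_trivIset => i j ij; apply/seteqP; split => // x [].
rewrite /dyadic/= !in_itv/= => /andP[_ x1] /andP[x2 _].
have := lt_le_trans x2 x1.
by rewrite ltrD2r ltr_pM2r ?invr_gt0 ?exprn_gt0// ltr_nat ltnNge ij.
Qed.

Definition dyadic_inner (U : set R) n : set R :=
  \big[setU/set0]_(k < (n * 2) * 2 ^ n | `[< dyadic n k `<=` U >]) dyadic n k.

Lemma dyadic_inner_sub U n : dyadic_inner U n `<=` U.
Proof.
rewrite /dyadic_inner; apply: (big_ind (fun A => A `<=` U)) => //.
  by move=> A B AU BU x [/AU|/BU].
by move=> i /asboolP.
Qed.

Lemma measurable_dyadic n k : measurable (dyadic n k).
Proof. exact: measurable_itv. Qed.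

Lemma measurable_dyadic_inner U n : measurable (dyadic_inner U n).
Proof. by apply: bigsetU_measurable => i _; exact: measurable_dyadic. Qed.

(** An open set is exhausted by finite disjoint unions of intervals, which are
    the sets that absolute continuity speaks about. *)
Lemma near_dyadic_inner U x : open U -> U x ->
  \forall n \near \oo, dyadic_inner U n x.
Proof.
move=> oU Ux.
have /nbhs_ballP[r /= r0 rU] : nbhs x U by exact: open_nbhs_nbhs.
near=> n.
have nx : `|x| < n%:R by near: n; exact: nbhs_infty_gtr.
have p0 : 0 < 2 ^+ n :> R by rewrite exprn_gt0.
pose y := (x + n%:R) * 2 ^+ n.
have y0 : 0 < y by rewrite mulr_gt0// -ltrBlDr sub0r; move: nx; rewrite ltr_norml => /andP[].
pose k := `|Num.ceil y - 1|%N.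
have c0 : 0 <= Num.ceil y - 1 by rewrite subr_ge0 -gtz0_ge1 ceil_gt0.
have kE : k%:R = (Num.ceil y - 1)%:~R :> R by rewrite /k -[in RHS](gez0_abs c0).
have /andP[c1 c2] := ceil_itv y.
have k1 : k%:R < y by rewrite kE.
have k2 : y <= k.+1%:R by rewrite -natr1 kE rmorphB/= subrK.
have xk : dyadic n k x.
  by rewrite /dyadic/= in_itv/= ltrBlDr ltr_pdivrMr// lerBrDr ler_pdivlMr// k1.
have kn : (k < n * 2 * 2 ^ n)%N.
  rewrite -(ltr_nat R) (lt_trans k1)// natrM natrX ltr_pM2r// natrM.
  by move: nx; rewrite ltr_norml => /andP[]; lra.
rewrite /dyadic_inner -bigcup_seq_cond.
exists (Ordinal kn) => //=.
rewrite mem_index_enum/=; apply/asboolP => z; rewrite /dyadic/= in_itv/= => /andP[z1 z2].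
apply: rU; rewrite -ball_normE/=.
move: xk; rewrite /dyadic/= in_itv/= => /andP[x1 x2].
have h : (2 ^+ n)^-1 < r.
  near: n; have := near_infty_natSinv_expn_lt (PosNum r0).
  by apply: filterS => m; rewrite div1r.
have E : k.+1%:R / 2 ^+ n = k%:R / 2 ^+ n + (2 ^+ n)^-1 :> R.
  by rewrite -natr1 mulrDl mul1r.
by rewrite ltr_norml; lra.
Unshelve. all: by end_near. Qed.

Lemma lebesgue_stieltjes_oc (F : cumulative R R) (x y : R) : x <= y ->
  lebesgue_stieltjes_measure F `]x, y]%classic = (F y - F x)%:E.
Proof.
move=> xy; rewrite /lebesgue_stieltjes_measure /measure_extension.
by rewrite measurable_mu_extE/=; [rewrite wlength_itv_bnd|exact: is_ocitv].
Qed.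

Lemma dyadic_sum (nu : {measure set (measurableTypeR R) -> \bar R}) U n :
  nu (dyadic_inner U n) =
  (\sum_(k < (n * 2) * 2 ^ n | `[< dyadic n k `<=` U >]) nu (dyadic n k))%E.
Proof.
rewrite /dyadic_inner measure_bigsetU_ord//; first by move=> i; exact: measurable_dyadic.
by move=> i j _ _ /(dyadic_trivIset Logic.I Logic.I) /val_inj.
Qed.

(** A null set is contained in an open set U of small Lebesgue measure. The
    dyadic inner approximations of U are finite disjoint unions of intervals of
    small total length, so their Stieltjes measure is small, and it approaches
    that of U. *)
Lemma ac_line_dominates (F : cumulative R R) : ac_line F ->
  lebesgue_stieltjes_measure F `<< mu.
Proof.
move=> acF; apply/null_content_dominatesP => A mA muA0.
apply/eqP; rewrite eq_le measure_ge0 andbT; apply/lee_addgt0Pr => e e0.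
rewrite add0e.
have [d d0 Fd] := acF _ e0.
have [|U [oU AU UAd]] := lebesgue_regularity_outer mA _ d0; first by rewrite muA0.
have mU : measurable U by exact: open_measurable.
have muU : (mu U < d%:E)%E.
  apply: le_lt_trans UAd; apply: (@le_trans _ _ (mu (A `|` (U `\` A)))).
    apply: le_measure; rewrite ?inE//; first by apply: measurableU => //; exact: measurableD.
    by move=> x Ux; have [|] := pselect (A x); [left|right].
  apply: le_trans (measureU2 mu mA (measurableD mU mA)) _.
  by rewrite [X in (X + _)%E]muA0 add0e.
(* the cells that stick out of U are replaced by the empty interval ]0, 0[ *)
pose u n k : R := if `[< dyadic n k `<=` U >] then k%:R / 2 ^+ n - n%:R else 0.
pose v n k : R := if `[< dyadic n k `<=` U >] then k.+1%:R / 2 ^+ n - n%:R else 0.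
have uv n k : u n k <= v n k.
  rewrite /u /v; case: ifP => // _.
  by rewrite lerD2r ler_pM2r ?invr_gt0 ?exprn_gt0// ler_nat.
have uvtriv n : trivIset setT (fun k : nat => `]u n k, v n k[%classic).
  move=> i j _ _ [x [/= xi xj]]; apply: (@dyadic_trivIset n) => //.
  suff {i j xi xj} sub i : x \in `]u n i, v n i[ -> dyadic n i x.
    by exists x; split; apply: sub.
  rewrite /u /v; case: ifP => _; last by rewrite in_itv/= => /andP[/lt_trans h /h]; rewrite ltxx.
  by rewrite /dyadic/= !in_itv/= => /andP[-> /ltW].
have nudy n : (lebesgue_stieltjes_measure F (dyadic_inner U n) <= e%:E)%E.
  rewrite dyadic_sum big_mkcond/=.
  have -> : (\sum_(k < (n * 2) * 2 ^ n)
      (if `[< dyadic n k `<=` U >] then lebesgue_stieltjes_measure F (dyadic n k) else 0) =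
     \sum_(k < (n * 2) * 2 ^ n) (`|F (v n k) - F (u n k)|)%:E)%E.
    apply: eq_bigr => k _; have := uv n k; rewrite /u /v; case: ifP => _ h; last by rewrite subrr normr0.
    rewrite lebesgue_stieltjes_oc// ger0_norm// subr_ge0.
    exact: (cumulative_is_nondecreasing F).
  rewrite sumEFin lee_fin ltW//; apply: (Fd _ (fun k : 'I__ => u n k) (fun k : 'I__ => v n k)) => //.
    by move=> i j _ _ /(uvtriv n _ _ Logic.I Logic.I) /val_inj.
  rewrite -lte_fin; apply: le_lt_trans muU; apply: (@le_trans _ _ (mu (dyadic_inner U n))).
    rewrite (dyadic_sum mu) -sumEFin [leRHS]big_mkcond/=; apply: lee_sum => k _.
    have := uv n k; rewrite /u /v; case: ifP => _ h; last by rewrite subrr.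
    rewrite lebesgue_measure_itv/= lte_fin; case: ltP => // h'.
    have hh := le_anti (introT andP (conj h h')).
    by rewrite lee_fin subr_le0.
  apply: le_measure; rewrite ?inE//; [exact: measurable_dyadic_inner|exact: dyadic_inner_sub].
(* tail intersections: an increasing sequence without comparing two meshes *)
pose B n := \bigcap_(m in [set m | (n <= m)%N]) dyadic_inner U m.
have mB n : measurable (B n).
  by apply: bigcap_measurableType => m _; exact: measurable_dyadic_inner.
have BU : \bigcup_n B n = U.
  apply/seteqP; split => [x [n _ /(_ n)]|x Ux]; first by move=> /(_ (leqnn n)) /dyadic_inner_sub.
  have [n _ nx] := near_dyadic_inner oU Ux.
  by exists n => // m /= nm; exact: nx.
apply: (@le_trans _ _ (lebesgue_stieltjes_measure F U)).
  by apply: le_measure; rewrite ?inE.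
have cvB : (lebesgue_stieltjes_measure F \o B) n @[n --> \oo] --> lebesgue_stieltjes_measure F U.
  rewrite -[in X in _ --> X]BU; apply: nondecreasing_cvg_mu => //.
    by rewrite BU.
  by move=> n m nm; apply/subsetPset => x Bx k /= mk; apply: Bx => /=; exact: leq_trans mk.
rewrite -(cvg_lim _ cvB)//; apply: lime_le; first by apply/cvg_ex; eexists; exact: cvB.
apply: nearW => n /=; apply: le_trans (nudy n).
apply: le_measure; rewrite ?inE; [exact: mB|exact: measurable_dyadic_inner|].
by move=> x /(_ n (leqnn n)).
Qed.

Lemma ac_line_continuous (f : R -> R) : ac_line f -> continuous f.
Proof.
move=> acf x; apply/cvgrPdist_lt => e e0.
have [d d0 h] := acf _ e0.
apply/nbhs_ballP; exists d => //= y /= xy.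
have := h unit (fun=> Num.min x y) (fun=> Num.max x y).
have T (c : R) : \sum_(i : unit) c = c by rewrite big_const card_unit/= addr0.
rewrite !T; case: (leP x y) xy => [xy|/ltW yx].
  rewrite distrC ger0_norm ?subr_ge0// => xyd.
  by rewrite distrC; apply => // [] [] [].
rewrite ger0_norm ?subr_ge0// => xyd.
by apply => // [] [] [].
Qed.

(** The density is the Radon-Nikodym derivative of the Stieltjes measure
    restricted to ]0, 1], where it is finite; Lebesgue's differentiation theorem
    identifies it with the derivative of its primitive. *)
Lemma ac_line_density (F : cumulative R R) : ac_line F ->
  exists g : R -> R, [/\ mu.-integrable setT (EFin \o g),
    forall x y, 0 <= x -> x <= y -> y <= 1 ->
      (F y - F x)%:E = (\int[mu]_(t in `]x, y]) (g t)%:E)%E &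
    {ae mu, forall x : R, 0 < x < 1 -> is_derive x (1 : R) F (g x)}].
Proof.
move=> acF.
pose I : set (measurableTypeR R) := `]0%R, 1%R]%classic.
have mI : measurable I by exact: measurable_itv.
pose nu0 := mrestr (lebesgue_stieltjes_measure F) mI.
have fnu : fin_num_fun nu0.
  apply: lty_fin_num_fun; rewrite /nu0 /mrestr.
  rewrite /= /mrestr setTI lebesgue_stieltjes_oc//.
  by rewrite ltry.
pose nu : {finite_measure set (measurableTypeR R) -> \bar R} :=
  HB.pack nu0 (Measure_isFinite.Build _ _ _ nu0 fnu).
have numu : nu `<< mu.
  apply/null_content_dominatesP => A mA A0.
  have /null_content_dominatesP := ac_line_dominates acF.
  move=> /(_ _ mA A0) h; apply/eqP; rewrite eq_le measure_ge0 andbT -[leRHS]h.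
  by apply: le_measure; rewrite ?inE//; exact: measurableI.
have [gE [g0 gfin gint gE_]] := radon_nikodym_sigma_finite numu.
pose g x := fine (gE x).
have gg x : (g x)%:E = gE x by rewrite /g fineK.
have gi : mu.-integrable setT (EFin \o g).
  by apply: eq_integrable gint => // x _ /=; rewrite gg.
have Fg x y : 0 <= x -> x <= y -> y <= 1 ->
    (F y - F x)%:E = (\int[mu]_(t in `]x, y]) (g t)%:E)%E.
  move=> x0 xy y1; under eq_integral do rewrite gg.
  rewrite -gE_; last exact: measurable_itv.
  rewrite /nu/= /nu0 /mrestr setIidl; first by rewrite lebesgue_stieltjes_oc.
  by move=> t /=; rewrite /I/= !in_itv/= => /andP[/(le_lt_trans x0) -> /le_trans -> //].
exists g; split => //.
have gloc : locally_integrable setT g.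
  by apply: open_integrable_locally => //; exact: openT.
have giy y : mu.-integrable [set` Interval (BRight 0) (BRight y)] (EFin \o g).
  by apply: integrableS gi => //; exact: measurable_itv.
have := FTC1 giy gloc; apply: filterS; first exact: (ae_filter_ringOfSetsType mu).
move=> x h /andP[x0 x1].
have [] := h x0.
set G := (fun z => _) => dG G'.
have FG : \forall z \near x, F z = G z + F 0.
  near=> z.
  have z0 : 0 < z by near: z; exact: lt_nbhsr.
  have z1 : z < 1 by near: z; exact: lt_nbhsl.
  have := Fg 0 z (lexx _) (ltW z0) (ltW z1).
  rewrite /G /Rintegral => <- /=.
  by rewrite subrK.
have dG2 : is_derive x (1 : R) G (g x).
  by rewrite -G' derive1E; exact: DeriveDef.
have -> : g x = g x + 0 by rewrite addr0.
have /near_eq_is_derive : \forall z \near x, (G \+ cst (F 0)) z = F z.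
  by apply: filterS FG => z ->.
by apply => //; apply: is_deriveD.
Unshelve. all: by end_near. Qed.

Lemma disjoint_homo T (phi : R -> R) (u v : T -> R) : nondecreasing phi ->
  trivIset setT (fun i => `]u i, v i[%classic) ->
  trivIset setT (fun i => `]phi (u i), phi (v i)[%classic).
Proof.
move=> phin uv i j _ _ [x [/=]]; rewrite !in_itv/= => /andP[a b] /andP[c d].
apply: uv => //.
have ui : u i < v i.
  by rewrite ltNge; apply/negP => /phin; rewrite leNgt (lt_trans a b).
have uj : u j < v j.
  by rewrite ltNge; apply/negP => /phin; rewrite leNgt (lt_trans c d).
have uij : u i < v j.
  by rewrite ltNge; apply/negP => /phin; rewrite leNgt (lt_trans a d).
have uji : u j < v i.
  by rewrite ltNge; apply/negP => /phin; rewrite leNgt (lt_trans c b).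
exists ((Num.max (u i) (u j) + Num.min (v i) (v j)) / 2); split => /=;
  rewrite in_itv/=; case: (leP (u i) (u j)); case: (leP (v i) (v j)) => *; lra.
Qed.

Lemma ac_line_comp (f phi : R -> R) : nondecreasing phi ->
  (forall x y, x <= y -> phi y - phi x <= y - x) -> ac_line f -> ac_line (f \o phi).
Proof.
move=> phin phi1 acf e e0; have [d d0 h] := acf _ e0; exists d => // T u v uv tuv s.
apply: (h T (phi \o u) (phi \o v)).
- by move=> i; exact: phin.
- exact: disjoint_homo tuv.
- by apply: le_lt_trans s; apply: ler_sum => i _; exact: phi1.
Qed.

Section variation.
Context (f : R -> R).

(** Subdividing each interval of a disjoint family gives another disjoint
    family, indexed by pairs, of the same total length. *)
Lemma ac_line_variation e d : 
  (forall (T : finType) (u v : T -> R),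
      (forall i, u i <= v i) ->
      trivIset setT (fun i => `]u i, v i[%classic) ->
      \sum_i (v i - u i) < d -> \sum_i `|f (v i) - f (u i)| < e) ->
  forall (T : finType) (u v : T -> R) (s : T -> seq R),
      (forall i, itv_partition (u i) (v i) (s i)) ->
      trivIset setT (fun i => `]u i, v i[%classic) ->
      \sum_i (v i - u i) < d -> \sum_i variation (u i) (v i) f (s i) < e.
Proof.
move=> h T u v s us tuv sd.
pose T' := {i : T & 'I_(size (s i))}.
pose U (p : T') := nth (v (tag p)) (u (tag p) :: s (tag p)) (tagged p).
pose V (p : T') := nth (v (tag p)) (u (tag p) :: s (tag p)) (tagged p).+1.
have so i : sorted <%O (u i :: s i) by case: (us i).
have mono i j k : (j <= k)%N -> (k <= size (s i))%N ->
    nth (v i) (u i :: s i) j <= nth (v i) (u i :: s i) k.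
  move=> jk ks; have := so i; rewrite lt_sorted_uniq_le => /andP[_ so'].
  apply: (sorted_leq_nth (@le_trans _ _) (@lexx _ _)) => //; rewrite inE/= ltnS//.
  exact: leq_trans ks.
have UV p : U p <= V p by apply: mono.
have sub p : `]U p, V p[ `<=` `]u (tag p), v (tag p)[.
  apply: subset_itv; rewrite bnd_simp /U /V.
    by apply: itv_partition_nth_ge (us _); rewrite ltnS ltnW.
  by apply: itv_partition_nth_le (us _); rewrite ltnS.
have tUV : trivIset setT (fun p => `]U p, V p[%classic).
  move=> p q _ _ [x [xp xq]].
  have pq : tag p = tag q.
    by apply: tuv => //; exists x; split; exact: sub.
  case: p q pq xp xq => [i k] [j l] /= ij; subst j; rewrite /U /V/= !in_itv/=.
  move=> /andP[a b] /andP[c d'].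
  congr existT; apply/val_inj/eqP; rewrite /= eqn_leq; apply/andP; split.
    rewrite leqNgt; apply/negP => lk.
    have := @mono i l.+1 k lk (ltnW (ltn_ord k)).
    by rewrite leNgt => /negP; apply; rewrite (lt_trans a d').
  rewrite leqNgt; apply/negP => lk.
  have := @mono i k.+1 l lk (ltnW (ltn_ord l)).
  by rewrite leNgt => /negP; apply; rewrite (lt_trans c b).
have := h _ U V UV tUV.
rewrite -(@sig_big_dep _ _ _ T (fun i => 'I_(size (s i))) xpredT (fun _ _ => true)
  (fun i k => nth (v i) (u i :: s i) k.+1 - nth (v i) (u i :: s i) k))/=.
rewrite -(@sig_big_dep _ _ _ T (fun i => 'I_(size (s i))) xpredT (fun _ _ => true)
  (fun i k => `|f (nth (v i) (u i :: s i) k.+1) - f (nth (v i) (u i :: s i) k)|))/=.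
under [X in _ -> X < _]eq_bigr do rewrite /variation big_mkord.
apply; apply: le_lt_trans sd; apply: ler_sum => i _.
rewrite -(big_mkord xpredT (fun k => nth (v i) (u i :: s i) k.+1 - nth (v i) (u i :: s i) k)).
by rewrite telescope_sumr// (itv_partition_nth_size _ (us i)).
Qed.

(** The total variation is a supremum over subdivisions, and the subdivisions
    of the different intervals can be chosen independently. *)
Lemma ac_line_total_variation : ac_line f -> forall e : R, 0 < e ->
  exists2 d : R, 0 < d &
  forall (T : finType) (u v : T -> R),
      (forall i, u i <= v i) ->
      trivIset setT (fun i => `]u i, v i[%classic) ->
      \sum_i (v i - u i) < d -> (\sum_i total_variation (u i) (v i) f <= e%:E)%E.
Proof.
move=> acf e e0; have [d d0 h] := acf _ e0; exists d => // T u v uv tuv sd.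
have {}h := ac_line_variation h _ tuv sd.
(* an empty interval is only partitioned by the empty sequence *)
pose triv i := if u i < v i then [:: v i] else [::].
have trivP i : itv_partition (u i) (v i) (triv i).
  rewrite /triv; case: ltP => [|vu]; first exact: itv_partition1.
  by split => //=; rewrite eq_le uv vu.
have TVe i : (total_variation (u i) (v i) f <= e%:E)%E.
  apply: ge_ereal_sup => _ [_ [s sp <-] <-]; rewrite lee_fin.
  have sp' j : itv_partition (u j) (v j) (if j == i then s else triv j).
    by case: eqP => [->|_].
  apply: le_trans (ltW (h _ sp')); rewrite (bigD1 i)//= eqxx lerDl.
  by apply: sumr_ge0 => j _; exact: variation_ge0.
have TVfin i : total_variation (u i) (v i) f \is a fin_num.
  rewrite ge0_fin_numE; last exact: total_variation_ge0.
  by apply: le_lt_trans (TVe i) _; rewrite ltry.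
apply/lee_addgt0Pr => n n0.
have n'0 : 0 < n / #|T|.+1%:R by rewrite divr_gt0.
have /choice[s sP] : forall i, exists s, itv_partition (u i) (v i) s /\
    (total_variation (u i) (v i) f <= (variation (u i) (v i) f s + n / #|T|.+1%:R)%:E)%E.
  move=> i; have [_ [_ [s sp <-] <-] hs] := ub_ereal_sup_adherent n'0 (TVfin i).
  by exists s; split => //; rewrite EFinD -leeBlDr// ltW.
apply: (@le_trans _ _ (\sum_i (variation (u i) (v i) f (s i) + n / #|T|.+1%:R)%:E)%E).
  by apply: lee_sum => i _; have [] := sP i.
rewrite sumEFin -EFinD lee_fin big_split/=; apply: lerD.
  by apply: ltW; apply: h => i; have [] := sP i.
rewrite big_const iter_addr_0 -[leLHS]mulr_natr -mulrA ger_pMr// mulrC ler_pdivrMr// mul1r.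
by rewrite ler_nat.
Qed.

(** The variation is at most 1 on intervals shorter than some d, and it is
    additive. *)
Lemma ac_line_total_variation_fin : ac_line f -> forall x y, x <= y ->
  total_variation x y f \is a fin_num.
Proof.
move=> acf; have [d d0 h] := ac_line_total_variation acf ltr01.
have small x y : x <= y -> y - x < d -> total_variation x y f \is a fin_num.
  move=> xy yx; rewrite ge0_fin_numE; last exact: total_variation_ge0.
  have := h unit (fun=> x) (fun=> y).
  rewrite !big_const !card_unit/= addr0 adde0 => /(_ (fun=> xy)).
  move=> /(_ _ yx) H; apply: le_lt_trans (H _) _; last by rewrite ltry.
  by move=> [] [].
have step n : forall x y, x <= y -> y - x < n%:R * (d / 2) -> total_variation x y f \is a fin_num.
  elim: n => [|n IH] x y xy.
    by rewrite mul0r subr_lt0 ltNge xy.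
  have [yx _|yx] := ltP (y - x) d; first exact: small.
  rewrite -natr1 mulrDl mul1r => yx2.
  have d2 : d / 2 < d by lra.
  rewrite (@total_variationD _ _ _ (x + d / 2)); [|lra|lra].
  rewrite fin_numD small/=; [|lra|lra].
  by apply: IH; lra.
move=> x y xy; apply: (step (Num.truncn ((y - x) / (d / 2))).+1) => //.
rewrite -ltr_pdivrMr; last by lra.
by rewrite truncnS_gt.
Qed.

End variation.

Lemma ac_lineB f g : ac_line f -> ac_line g -> ac_line (f \- g).
Proof.
move=> acf acg e e0.
have e2 : 0 < e / 2 by lra.
have [d1 d10 h1] := acf _ e2; have [d2 d20 h2] := acg _ e2.
exists (Num.min d1 d2); first by rewrite lt_min d10.
move=> T u v uv tuv; rewrite lt_min => /andP[s1 s2].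
have := h1 T u v uv tuv s1; have := h2 T u v uv tuv s2.
suff : \sum_i `|(f \- g) (v i) - (f \- g) (u i)| <=
  \sum_i `|f (v i) - f (u i)| + \sum_i `|g (v i) - g (u i)| by lra.
rewrite -big_split/=; apply: ler_sum => i _.
have -> : (f \- g) (v i) - (f \- g) (u i) = (f (v i) - f (u i)) - (g (v i) - g (u i)).
  by rewrite /=; ring.
exact: ler_normB.
Qed.

Lemma ac_line_lipschitz (f : R -> R) (K : R) :
  (forall x y, x <= y -> `|f y - f x| <= K * (y - x)) -> ac_line f.
Proof.
move=> fK e e0; exists (e / (`|K| + 1)); first by rewrite divr_gt0// ltr_wpDl.
move=> T u v uv _ s; have K1 : 0 < `|K| + 1 by rewrite ltr_wpDl.
rewrite ltr_pdivlMr// mulrC mulr_sumr in s.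
apply: le_lt_trans s; apply: ler_sum => i _.
apply: le_trans (fK _ _ (uv i)) _; rewrite ler_wpM2r ?subr_ge0//.
by apply: le_trans (ler_norm _) _; rewrite lerDl.
Qed.

Lemma ac_lineD (f g : R -> R) : ac_line f -> ac_line g -> ac_line (f \+ g).
Proof.
move=> acf acg.
have -> : f \+ g = f \- (cst 0 \- g) by apply/funext => x /=; ring.
apply: ac_lineB => //; apply: ac_lineB => //.
by apply: (@ac_line_lipschitz _ 0) => x y _; rewrite subrr normr0 mul0r.
Qed.

(** Jordan's decomposition f = V - (V - f), with V the total variation from 0.
    Constancy of f on the negative half-line makes 0 a sufficient origin. *)
Lemma ac_line_decomposition f : ac_line f -> (forall x, x <= 0 -> f x = f 0) ->
  exists F1 F2 : cumulative R R, [/\ ac_line F1, ac_line F2 & forall x, f x = F1 x - F2 x].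
Proof.
move=> acf f0.
pose p x : R := Num.max 0 x.
have pn : nondecreasing p.
  by move=> x y xy; rewrite /p ge_max le_max lexx/= le_max xy orbT.
have p1 x y : x <= y -> p y - p x <= y - x.
  by rewrite /p; case: (leP 0 x); case: (leP 0 y); lra.
have p0 x : 0 <= p x by rewrite /p le_max lexx.
have fp x : f (p x) = f x by rewrite /p; case: leP => // /ltW /f0.
have fin := ac_line_total_variation_fin acf.
pose V x := fine (total_variation 0 (p x) f).
have VB x y : x <= y -> V y - V x = fine (total_variation (p x) (p y) f).
  move=> xy; rewrite /V (@total_variationD _ _ _ (p x))//; last exact: pn.
  by rewrite fineD ?fin ?pn// addrAC subrr add0r.
have Vn : nondecreasing V.
  move=> x y xy; rewrite -subr_ge0 VB// fine_ge0// total_variation_ge0//; exact: pn.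
have acV : ac_line V.
  move=> e e0; have e2 : 0 < e / 2 by lra.
  have [d d0 h] := ac_line_total_variation acf e2; exists d => // T u v uv tuv sd.
  apply: (@le_lt_trans _ _ (e / 2)); last lra.
  rewrite -lee_fin; apply: le_trans (h T (p \o u) (p \o v) _ _ _).
  - rewrite -sumEFin; apply: lee_sum => i _; rewrite VB// ger0_norm.
      by rewrite fineK// fin//; exact: pn.
    by rewrite fine_ge0// total_variation_ge0//; exact: pn.
  - by move=> i; exact: pn.
  - exact: disjoint_homo tuv.
  - by apply: le_lt_trans sd; apply: ler_sum => i _; exact: p1.
pose W := V \- f.
have Wn : nondecreasing W.
  move=> x y xy; rewrite /W/= lerBlDr addrAC lerBrDr -lerBlDl -lerBrDr -lerBlDl opprK.
  rewrite -subr_ge0.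
  have : f y - f x <= V y - V x.
    rewrite VB// -lee_fin fineK; last by rewrite fin//; exact: pn.
    apply: le_trans (total_variation_ge f (pn _ _ xy)).
    by rewrite lee_fin !fp ler_norm.
  lra.
have acW : ac_line W by exact: ac_lineB.
pose F1 : cumulative R R := HB.pack V
  (isCumulative.Build R _ R V Vn (right_continuousW (ac_line_continuous acV))).
pose F2 : cumulative R R := HB.pack W
  (isCumulative.Build R _ R W Wn (right_continuousW (ac_line_continuous acW))).
by exists F1, F2; split => // x /=; rewrite /W/= opprB addrCA subrr addr0.
Qed.

(** Lebesgue's fundamental theorem of calculus, by Jordan's decomposition. *)
Lemma ac_line_FTC f : ac_line f -> (forall x, x <= 0 -> f x = f 0) ->
  exists g : R -> R, [/\ mu.-integrable setT (EFin \o g),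
    forall x y, 0 <= x -> x <= y -> y <= 1 ->
      (f y - f x)%:E = (\int[mu]_(t in `]x, y]) (g t)%:E)%E &
    {ae mu, forall x : R, 0 < x < 1 -> is_derive x (1 : R) f (g x)}].
Proof.
move=> acf f0; have [F1 [F2 [ac1 ac2 fE]]] := ac_line_decomposition acf f0.
have [g1 [i1 I1 D1]] := ac_line_density ac1.
have [g2 [i2 I2 D2]] := ac_line_density ac2.
have -> : f = F1 \- F2 by apply/funext => x; rewrite fE.
exists (g1 \- g2); split.
- by have := integrableB measurableT i1 i2; apply: eq_integrable.
- move=> x y x0 xy y1 /=.
  under eq_integral do rewrite EFinB.
  have mxy : measurable (`]x, y]%classic : set R) by exact: measurable_itv.
  rewrite integralB//; [|exact: integrableS i1|exact: integrableS i2].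
  by rewrite -I1// -I2// -EFinB; congr (_%:E); ring.
- apply: (@filterS2 _ _ (ae_filter_ringOfSetsType mu) _ _ _ _ D1 D2) => x d1 d2 x01.
  by apply: is_deriveB; [exact: d1|exact: d2].
Qed.

End dominated.

(** * Measurability of the derivative *)

Section measurable_derivative.
Context {R : realType}.
Context (f : R -> R) (cf : continuous f).

Let Q (h x : R) : R := h^-1 * (f (h + x) - f x).

Let cQ h : continuous (Q h).
Proof.
move=> x; apply: cvgM; first exact: cvg_cst.
apply: cvgB; last exact: cf.
apply: (@continuous_comp _ _ _ (fun x => h + x) f); last exact: cf.
by apply: cvgD; [exact: cvg_cst|exact: cvg_id].
Qed.

Let QE h x : h^-1 *: (f (h *: 1 + x) - f x) = Q h x.
Proof. by rewrite /Q [h *: _]mulr1. Qed.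

(** The points at which all difference quotients of step below 1/(m+1) agree
    up to 1/(k+1). For given steps this is a closed condition, by continuity of
    f, so that uncountably many steps do no harm. *)
Let osc k m := [set x | forall h h' : R, 0 < `|h| < m.+1%:R^-1 ->
   0 < `|h'| < m.+1%:R^-1 -> `|Q h x - Q h' x| <= k.+1%:R^-1].

Let closed_osc k m : closed (osc k m).
Proof.
have -> : osc k m = \bigcap_(p in [set p : R * R |
      (0 < `|p.1| < m.+1%:R^-1) /\ (0 < `|p.2| < m.+1%:R^-1)])
    ((fun x => `|Q p.1 x - Q p.2 x|) @^-1` [set y | y <= k.+1%:R^-1]).
  apply/seteqP; split => [x ox [h h'] [/= ? ?]|x ox h h' ? ?]; first exact: ox.
  exact: (ox (h, h')).
apply: closed_bigI => p _; apply: preimage_closed; last exact: closed_le.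
move=> x _; apply: cvg_norm; apply: cvgB; exact: cQ.
Qed.

Let derivable_osc x : derivable f x 1 <-> forall k, exists m, osc k m x.
Proof.
split => [|ox].
  rewrite /derivable; under eq_fun do rewrite QE.
  move=> /cvg_ex[l /= /cvgrPdist_lt Ql] k.
  have k0 : (0 : R) < k.+1%:R^-1 / 2 by rewrite divr_gt0.
  have /nbhs_ballP[d /= d0 hd] := Ql _ k0.
  exists (Num.truncn d^-1) => h h' /andP[h0 hm] /andP[h'0 h'm].
  have md : (Num.truncn d^-1).+1%:R^-1 < d.
    by rewrite invf_plt ?posrE// truncnS_gt.
  have Qd t : 0 < `|t| -> `|t| < (Num.truncn d^-1).+1%:R^-1 -> `|l - Q t x| < k.+1%:R^-1 / 2.
    move=> t0 tm; apply: hd => //=; last by rewrite -normr_gt0.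
    by rewrite /ball/= sub0r normrN (lt_trans tm).
  rewrite (le_trans (ler_distD l _ _))// distrC [leRHS]splitr ltW// ltrD//; exact: Qd.
rewrite /derivable; under eq_fun do rewrite QE.
apply/cauchy_cvgP; apply/cauchy_ballP => e e0.
have [m om] := ox (Num.truncn e^-1).
have kd : (Num.truncn e^-1).+1%:R^-1 < e by rewrite invf_plt ?posrE// truncnS_gt.
pose A := [set Q h x | h in [set h | 0 < `|h| < m.+1%:R^-1]].
exists (A, A).
  suff : (Q^~ x @ 0^') A by [].
  apply/nbhs_ballP; exists (m.+1%:R^-1) => //= h /=; rewrite /ball/= sub0r normrN => hm h0.
  by exists h => //=; rewrite normr_gt0 h0.
move=> [_ _] [/= [h hm <-] [h' h'm <-]].
by rewrite /ball/= (le_lt_trans (om _ _ _ _)).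
Qed.

Lemma measurable_derivable : measurable [set x | derivable f x 1].
Proof.
have -> : [set x | derivable f x 1] = \bigcap_k \bigcup_m osc k m.
  apply/seteqP; split => x /=.
    by move=> /derivable_osc h k _; have [m] := h k; exists m.
  by move=> h; apply/derivable_osc => k; have [m _ ?] := h k Logic.I; exists m.
apply: bigcapT_measurable => k; apply: bigcupT_measurable => m.
rewrite -(setCK (osc k m)); apply: measurableC; apply: open_measurable.
exact/closed_openC/closed_osc.
Qed.

(** At a point where f is not derivable, the value of its derivative is the
    default 0, which the indicator function supplies. *)
Lemma measurable_derive1 : measurable_fun setT (f^`()%classic : R -> R).
Proof.
pose D := [set x | derivable f x 1].
apply: (@measurable_fun_cvg _ _ _ setT (fun n x => \1_D x * Q n.+1%:R^-1 x)) => [n|x _].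
  apply: measurable_funM; first by apply: measurable_indic; exact: measurable_derivable.
  exact: continuous_measurable_fun.
have [Dx|nDx] := pselect (derivable f x 1).
  have xD : x \in D by rewrite inE.
  rewrite indicE xD; under eq_fun do rewrite mul1r.
  have : Q h x @[h --> 0^'] --> f^`()%classic x.
    by move: Dx; rewrite /derivable; under eq_fun do rewrite QE.
  move=> /cvgrPdist_lt H; apply/cvgrPdist_lt => e e0.
  have /nbhs_ballP[d /= d0 hd] := H _ e0.
  near=> n.
  apply: (hd n.+1%:R^-1) => //=.
  rewrite /ball/= sub0r normrN ger0_norm//.
  by near: n; exact: near_infty_natSinv_lt (PosNum d0).
have nc : ~ cvg (Q h x @[h --> 0^']).
  by move=> c; apply: nDx; rewrite /derivable; under eq_fun do rewrite QE.
have -> : f^`()%classic x = 0 by rewrite /derive1; exact: (dvgP nc).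
have xD : x \notin D by apply/negP => /set_mem /nDx.
rewrite indicE (negbTE xD); under eq_fun do rewrite mul0r; exact: cvg_cst.
Unshelve. all: by end_near. Qed.

End measurable_derivative.

(** * Length and time of flight of absolutely continuous curves *)

Section curves.
Context {R : realType}.
Implicit Types (p q : R * R) (a b : R -> R * R) (s t u v x y : R).
Notation mu := (@lebesgue_measure R).

Lemma enorm_ge0 p : 0 <= enorm p. Proof. exact: sqrtr_ge0. Qed.

Lemma dot_ge0 p : 0 <= dot p p.
Proof. by rewrite /dot -!expr2 addr_ge0 ?sqr_ge0. Qed.

Lemma sqr_enorm p : enorm p ^+ 2 = p.1 ^+ 2 + p.2 ^+ 2.
Proof. by rewrite /enorm sqr_sqrtr ?dot_ge0. Qed.

Lemma enorm_eq0 p : enorm p = 0 -> p = 0.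
Proof.
move=> p0; have := sqr_enorm p; rewrite p0 expr0n/= => /esym/eqP.
rewrite paddr_eq0 ?sqr_ge0// !sqrf_eq0 => /andP[/eqP p1 /eqP p2].
by rewrite [p]surjective_pairing p1 p2.
Qed.

Lemma fst_le_enorm p : `|p.1| <= enorm p.
Proof.
rewrite -(@ler_pXn2r _ 2)// ?nnegrE ?enorm_ge0// sqr_enorm -normrX.
by rewrite ger0_norm ?sqr_ge0// lerDl sqr_ge0.
Qed.

Lemma snd_le_enorm p : `|p.2| <= enorm p.
Proof.
rewrite -(@ler_pXn2r _ 2)// ?nnegrE ?enorm_ge0// sqr_enorm -normrX.
by rewrite ger0_norm ?sqr_ge0// lerDr sqr_ge0.
Qed.

Lemma enorm_le_sum p : enorm p <= `|p.1| + `|p.2|.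
Proof.
rewrite -(@ler_pXn2r _ 2)// ?nnegrE ?enorm_ge0 ?addr_ge0// sqr_enorm sqrrD.
by rewrite !real_normK ?num_real// addrAC lerDl mulrn_wge0// mulr_ge0.
Qed.

Lemma enorm_le p (c : R) : 0 <= c -> p.1 ^+ 2 + p.2 ^+ 2 <= c ^+ 2 -> enorm p <= c.
Proof. by move=> c0 h; rewrite -(@ler_pXn2r _ 2)// ?nnegrE ?enorm_ge0// sqr_enorm. Qed.

Lemma enorm0 : enorm (0 : R * R) = 0.
Proof. by rewrite /enorm /dot/= !mul0r addr0 sqrtr0. Qed.

Lemma dot_le p q : dot p q <= enorm p * enorm q.
Proof.
apply: le_trans (ler_norm _) _.
rewrite -(@ler_pXn2r _ 2)// ?nnegrE ?mulr_ge0 ?enorm_ge0// exprMn !sqr_enorm.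
rewrite real_normK ?num_real// /dot -subr_ge0.
rewrite (_ : _ - _ = (p.1 * q.2 - p.2 * q.1) ^+ 2) ?sqr_ge0//; ring.
Qed.

(** Composing with this retraction extends a curve on [0, 1] by constants. *)
Definition clamp01 x : R := Num.max 0 (Num.min x 1).

Lemma clamp01_nd : nondecreasing clamp01.
Proof.
move=> x y xy; rewrite /clamp01.
by case: (leP x 1) => x1; case: (leP y 1) => y1; rewrite ?(max_r ler01);
  try (case: (leP 0 x) => x0); try (case: (leP 0 y) => y0); lra.
Qed.

Lemma clamp01_lip x y : x <= y -> clamp01 y - clamp01 x <= y - x.
Proof.
move=> xy; rewrite /clamp01.
by case: (leP x 1) => x1; case: (leP y 1) => y1; rewrite ?(max_r ler01);
  try (case: (leP 0 x) => x0); try (case: (leP 0 y) => y0); lra.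
Qed.

Lemma clamp01_ge0 x : 0 <= clamp01 x.
Proof. by rewrite /clamp01 le_max lexx. Qed.

Lemma clamp01_le1 x : clamp01 x <= 1.
Proof. by rewrite /clamp01 ge_max ler01 ge_min lexx orbT. Qed.

Lemma clamp01_id x : 0 <= x -> x <= 1 -> clamp01 x = x.
Proof. by move=> x0 x1; rewrite /clamp01 min_l// max_r. Qed.

Lemma clamp01_le0 x : x <= 0 -> clamp01 x = clamp01 0.
Proof.
by move=> x0; rewrite [RHS]clamp01_id// /clamp01 max_l// ge_min x0.
Qed.

Lemma ac_line_clamp a (h : R * R -> R) : abs_continuous01 a ->
  (forall p q, `|h p - h q| <= enorm (p - q)) -> ac_line (h \o a \o clamp01).
Proof.
move=> aca hh e e0; have [d d0 ad] := aca _ e0; exists d => // T u v uv tuv sd.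
pose U (i : 'I_#|T|) := clamp01 (u (enum_val i)).
pose V (i : 'I_#|T|) := clamp01 (v (enum_val i)).
have UV i : [/\ 0 <= U i, U i <= V i & V i <= 1].
  by rewrite clamp01_ge0 clamp01_le1; split => //; exact: clamp01_nd.
apply: le_lt_trans (ad _ U V UV _ _).
- rewrite (reindex (@enum_val T T))/=; last first.
    by exists enum_rank => i _; rewrite ?enum_valK ?enum_rankK.
  by apply: ler_sum => i _; exact: hh.
- move=> i j _ _ ij; apply: enum_val_inj.
  by apply: (disjoint_homo clamp01_nd tuv).
- apply: le_lt_trans sd.
  rewrite [leRHS](reindex (@enum_val T T))/=; last first.
    by exists enum_rank => i _; rewrite ?enum_valK ?enum_rankK.
  by apply: ler_sum => i _; exact: clamp01_lip.
Qed.

Lemma ac_line_fst a : abs_continuous01 a -> ac_line (fst \o a \o clamp01).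
Proof. by move=> aca; apply: ac_line_clamp => // p q; exact: (fst_le_enorm (p - q)). Qed.

Lemma ac_line_snd a : abs_continuous01 a -> ac_line (snd \o a \o clamp01).
Proof. by move=> aca; apply: ac_line_clamp => // p q; exact: (snd_le_enorm (p - q)). Qed.

Lemma abs_continuous01_coords a (f g : R -> R) : ac_line f -> ac_line g ->
  (forall s, 0 <= s <= 1 -> a s = (f s, g s)) -> abs_continuous01 a.
Proof.
move=> acf acg afg e e0.
have e2 : 0 < e / 2 by rewrite divr_gt0.
have [d1 d10 h1] := acf _ e2; have [d2 d20 h2] := acg _ e2.
exists (Num.min d1 d2); first by rewrite lt_min d10.
move=> n u v uv tuv; rewrite lt_min => /andP[s1 s2].
have uv' i : u i <= v i by have [] := uv i.
have := h1 _ u v uv' tuv s1; have := h2 _ u v uv' tuv s2.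
suff : \sum_i enorm (a (v i) - a (u i)) <=
  \sum_i `|f (v i) - f (u i)| + \sum_i `|g (v i) - g (u i)| by lra.
rewrite -big_split/=; apply: ler_sum => i _; have [u0 uvi v1] := uv i.
rewrite !afg; first exact: enorm_le_sum.
  by rewrite u0 (le_trans uvi).
by rewrite (le_trans u0).
Qed.

Lemma near_eq_velocity a b s : {near s, a =1 b} -> velocity a s = velocity b s.
Proof.
move=> ab; rewrite /velocity !derive1E; congr pair; apply: near_eq_derive;
  by apply: filterS ab => x /= ->.
Qed.

Lemma velocity_clamp a s : 0 < s -> s < 1 -> velocity a s =
  ((fst \o a \o clamp01)^`()%classic s, (snd \o a \o clamp01)^`()%classic s).
Proof.
move=> s0 s1; apply: (@near_eq_velocity a (a \o clamp01)).
near=> x; rewrite /= clamp01_id//.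
  by apply: ltW; near: x; exact: lt_nbhsr.
by apply: ltW; near: x; exact: lt_nbhsl.
Unshelve. all: by end_near. Qed.

Lemma continuous_fst a : abs_continuous01 a -> continuous (fst \o a \o clamp01).
Proof. by move=> /ac_line_fst/ac_line_continuous. Qed.

Lemma continuous_snd a : abs_continuous01 a -> continuous (snd \o a \o clamp01).
Proof. by move=> /ac_line_snd/ac_line_continuous. Qed.

Lemma continuous_sqrt_sum (f g : R -> R) s : {for s, continuous f} -> {for s, continuous g} ->
  {for s, continuous (fun x => Num.sqrt (f x * f x + g x * g x))}.
Proof.
move=> cf cg; apply: (@continuous_comp _ _ _ (fun x => f x * f x + g x * g x) Num.sqrt).
  by apply: cvgD; apply: cvgM.
exact: sqrt_continuous.
Qed.

Lemma continuous_enorm a : abs_continuous01 a -> continuous (fun s => enorm (a (clamp01 s))).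
Proof.
move=> aca s; apply: (@continuous_sqrt_sum (fst \o a \o clamp01) (snd \o a \o clamp01)).
  exact: continuous_fst.
exact: continuous_snd.
Qed.

Lemma measurable_sqrt_sum (D : set R) (f g : R -> R) :
  measurable_fun D f -> measurable_fun D g ->
  measurable_fun D (fun x => Num.sqrt (f x * f x + g x * g x)).
Proof.
move=> mf mg; pose k x := f x * f x + g x * g x.
suff : measurable_fun D (Num.sqrt \o k) by [].
apply: measurableT_comp.
  by apply: continuous_measurable_fun; exact: sqrt_continuous.
by apply: measurable_funD; apply: measurable_funM.
Qed.

Lemma measurable_speed a : abs_continuous01 a ->
  measurable_fun (`]0, 1[%classic : set R) (fun s => enorm (velocity a s)).
Proof.
move=> aca.
pose f := (fst \o a \o clamp01)^`()%classic; pose g := (snd \o a \o clamp01)^`()%classic.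
apply: (eq_measurable_fun (fun x => Num.sqrt (f x * f x + g x * g x))).
  by move=> s; rewrite inE/= in_itv/= => /andP[s0 s1]; rewrite velocity_clamp.
apply: measurable_sqrt_sum; apply: measurable_funTS; apply: measurable_derive1.
  exact: continuous_fst.
exact: continuous_snd.
Qed.

(** With q the chord and g the almost everywhere velocity, the fundamental
    theorem gives |q|^2 = q . q as the integral of q . g, which is at most
    |q| |g|. *)
Lemma chord_le_length a u v : abs_continuous01 a -> 0 <= u -> u <= v -> v <= 1 ->
  ((enorm (a v - a u))%:E <= \int[mu]_(s in `]u, v[) (enorm (velocity a s))%:E)%E.
Proof.
move=> aca u0 uv v1.
have u1 := le_trans uv v1; have v0 := le_trans u0 uv.
have [||gx [ix Ix Dx]] := @ac_line_FTC R (fst \o a \o clamp01).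
- exact: ac_line_fst.
- by move=> x x0 /=; rewrite clamp01_le0.
have [||gy [iy Iy Dy]] := @ac_line_FTC R (snd \o a \o clamp01).
- exact: ac_line_snd.
- by move=> x x0 /=; rewrite clamp01_le0.
set q := a v - a u.
have [q0|q0] := eqVneq (enorm q) 0.
  by rewrite q0; apply: integral_ge0 => s _; rewrite lee_fin enorm_ge0.
have qp : 0 < enorm q by rewrite lt_neqAle eq_sym q0 enorm_ge0.
pose h s := Num.sqrt (gx s * gx s + gy s * gy s).
have mgx : measurable_fun setT gx by apply/measurable_EFinP; exact: measurable_int ix.
have mgy : measurable_fun setT gy by apply/measurable_EFinP; exact: measurable_int iy.
have mh : measurable_fun setT h by exact: measurable_sqrt_sum.
have muv : measurable (`]u, v[%classic : set R) by exact: measurable_itv.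
have muv' : measurable (`]u, v]%classic : set R) by exact: measurable_itv.
have sub01 : `]u, v[ `<=` `]0, 1[.
  by move=> x /=; rewrite !in_itv/= => /andP[/(le_lt_trans u0) -> /lt_le_trans ->].
have -> : (\int[mu]_(s in `]u, v[) (enorm (velocity a s))%:E = \int[mu]_(s in `]u, v[) (h s)%:E)%E.
  apply: ae_eq_integral => //.
  - apply/measurable_EFinP; apply: measurable_funS (measurable_speed aca) => //.
  - by apply/measurable_EFinP; exact: measurable_funTS.
  apply: (@filterS2 _ _ (ae_filter_ringOfSetsType mu) _ _ _ _ Dx Dy) => s dx dy.
  move=> /sub01; rewrite /= in_itv/= => s01; have /andP[s0 s1] := s01.
  rewrite velocity_clamp// !derive1E.
  by have := dx s01; have := dy s01 => dy' dx'; rewrite !derive_val.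
have -> : (\int[mu]_(s in `]u, v[) (h s)%:E = \int[mu]_(s in `]u, v]) (h s)%:E)%E.
  apply: integral_itv_bndo_bndc.
  by apply/measurable_EFinP; exact: measurable_funTS.
rewrite -(@lee_pmul2l _ (enorm q)%:E)//.
have -> : ((enorm q)%:E * \int[mu]_(s in `]u, v]) (h s)%:E =
    \int[mu]_(s in `]u, v]) ((enorm q)%:E * (h s)%:E))%E.
  rewrite ge0_integralZl//.
  - by apply/measurable_EFinP; exact: measurable_funTS.
  - by move=> s _; rewrite lee_fin sqrtr_ge0.
  - by rewrite lee_fin enorm_ge0.
have ix' : mu.-integrable `]u, v] (EFin \o gx) by apply: integrableS ix.
have iy' : mu.-integrable `]u, v] (EFin \o gy) by apply: integrableS iy.
pose F s := (q.1%:E * (gx s)%:E + q.2%:E * (gy s)%:E)%E.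
have iF : mu.-integrable `]u, v] F by apply: integrableD => //; exact: integrableZl.
have -> : ((enorm q)%:E * (enorm q)%:E = \int[mu]_(s in `]u, v]) F s)%E.
  rewrite /F integralD//; [|exact: integrableZl..].
  rewrite !integralZl// -Ix// -Iy//= !clamp01_id//.
  by rewrite -!EFinM -expr2 sqr_enorm !expr2.
apply: le_trans (lee_abs _) _; apply: le_trans (le_abse_integral _ _ _) _ => //.
  exact: measurable_int iF.
apply: ge0_le_integral => //.
- by apply: measurableT_comp => //; exact: measurable_int iF.
- apply: emeasurable_funM; first exact: measurable_cst.
  by apply/measurable_EFinP; exact: measurable_funTS.
- move=> s _; rewrite /F -!EFinM -EFinD lee_fin.
  have hE : h s = enorm (gx s, gy s) by [].
  have := dot_le q (gx s, gy s); have := dot_le (- q) (gx s, gy s).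
  have -> : enorm (- q) = enorm q by rewrite /enorm /dot/= !mulrNN.
  rewrite -hE /dot/= !mulNr => h1 h2; rewrite ler_norml; apply/andP; split; lra.
Qed.

(** The inverse of the speed v = sqrt (1/x - 1) at distance x from the origin,
    meant for 0 < x < 1: at x = 1 the time density is infinite, whereas this
    real inverse is 0. *)
Definition slowness x : R := (Num.sqrt (x^-1 - 1))^-1.

Definition time_density a s : \bar R :=
  ((enorm (velocity a s))%:E / sqrte ((enorm (a s))%:E^-1 - 1))%E.

Lemma time_densityE a s : 0 < enorm (a s) -> enorm (a s) < 1 ->
  time_density a s = (enorm (velocity a s) * slowness (enorm (a s)))%:E.
Proof.
move=> a0 a1; rewrite /time_density inver gt_eqF// -EFinB /= inver gt_eqF ?EFinM//.
by rewrite sqrtr_gt0 subr_gt0 invf_gt1.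
Qed.

Lemma time_density_ge0 a s : (0 <= time_density a s)%E.
Proof. by apply: mule_ge0; rewrite ?lee_fin ?enorm_ge0// inve_ge0 sqrte_ge0. Qed.

Lemma time_density1 a s : enorm (a s) = 1 ->
  time_density a s = ((enorm (velocity a s))%:E * +oo)%E.
Proof.
move=> a1; rewrite /time_density a1 inver gt_eqF// invr1 -EFinB subrr/=.
by rewrite sqrtr0 inve0.
Qed.

Lemma measurable_time_density a : abs_continuous01 a ->
  (forall s, 0 <= s <= 1 -> 0 < enorm (a s) <= 1) ->
  measurable_fun (`]0, 1[%classic : set R) (time_density a).
Proof.
move=> aca a01.
pose X s := enorm (a (clamp01 s)).
have cX : continuous X by exact: continuous_enorm.
have mv := measurable_speed aca.
have m01 : measurable (`]0, 1[%classic : set R) by exact: measurable_itv.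
have X0 s : 0 < X s.
  by have /andP[] := a01 (clamp01 s) (introT andP (conj (clamp01_ge0 s) (clamp01_le1 s))).
have oX : open [set s | X s < 1].
  by apply: (@open_comp _ _ X [set y | y < 1]) => //; move=> s _; exact: cX.
pose G s : \bar R := ((enorm (velocity a s))%:E *
  (if (X s < 1)%R then (slowness (X s))%:E else +oo))%E.
apply: (eq_measurable_fun G).
  move=> s; rewrite inE/= in_itv/= => /andP[s0 s1]; rewrite /G.
  have s01 : 0 <= s <= 1 by rewrite !ltW.
  have sE : X s = enorm (a s) by rewrite /X clamp01_id// ltW.
  have := a01 s s01; rewrite -sE => /andP[_].
  rewrite le_eqVlt => /orP[/eqP X1|X1].
    by rewrite time_density1 -?sE// X1 ltxx.
  by rewrite X1 time_densityE -?sE// EFinM.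
apply: emeasurable_funM; first exact/measurable_EFinP.
apply: measurable_funTS; apply: measurable_fun_if => //.
- apply: measurable_fun_ltr => //; exact: continuous_measurable_fun.
- rewrite setTI; apply/measurable_EFinP.
  have -> : (fun s => X s < 1) @^-1` [set true] = [set s | X s < 1] by [].
  apply: open_continuous_measurable_fun => // s; rewrite inE/= => Xs.
  have Xs0 : X s != 0 by rewrite gt_eqF.
  apply: cvgV; first by rewrite gt_eqF// sqrtr_gt0 subr_gt0 invf_gt1.
  apply: (@continuous_comp _ _ _ (fun s => (X s)^-1 - 1) Num.sqrt); last exact: sqrt_continuous.
  by apply: cvgB; [apply: cvgV => //; exact: cX|exact: cvg_cst].
Qed.

Lemma time_of_flight_oo a : measurable_fun (`]0, 1[%classic : set R) (time_density a) ->
  time_of_flight a = (\int[mu]_(s in `]0%R, 1%R[) time_density a s)%E.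
Proof. by move=> ma; rewrite /time_of_flight integral_itv_bndoo. Qed.

Definition outside (u v : R) : set R := `]0, 1[ `\` `]u, v[.

Lemma time_of_flight_split a u v : 0 <= u -> u <= v -> v <= 1 ->
  measurable_fun (`]0, 1[%classic : set R) (time_density a) ->
  time_of_flight a = (\int[mu]_(s in outside u v) time_density a s +
                      \int[mu]_(s in `]u, v[) time_density a s)%E.
Proof.
move=> u0 uv v1 ma; rewrite time_of_flight_oo//.
have sub01 : `]u, v[ `<=` `]0, 1[.
  by move=> x /=; rewrite !in_itv/= => /andP[/(le_lt_trans u0) -> /lt_le_trans ->].
have E : `]0, 1[%classic = outside u v `|` `]u, v[%classic by rewrite setUC setDUK.
rewrite {1}E ge0_integral_setU//.
- by apply: measurableD; exact: measurable_itv.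
- by rewrite -E.
- by move=> s _; exact: time_density_ge0.
- by rewrite /outside disj_set2E setDKI.
Qed.

End curves.

(** * Slowness as a function of the radius *)

Section slowness_facts.
Context {R : realType}.
Implicit Types (x y : R).

Lemma sqr_slowness x : 0 < x -> x < 1 -> slowness x ^+ 2 = x / (1 - x).
Proof.
move=> x0 x1; rewrite /slowness exprVn sqr_sqrtr; last first.
  by rewrite subr_ge0 invf_ge1// ltW.
rewrite (_ : x^-1 - 1 = (1 - x) / x) ?invf_div//.
by rewrite mulrBl mul1r divff// gt_eqF.
Qed.

Lemma slowness_ge0 x : 0 <= slowness x.
Proof. by rewrite invr_ge0 sqrtr_ge0. Qed.

(** Since slowness^2 = x / (1 - x), the squares at y and x differ by
    (y - x) / ((1 - x) (1 - y)), and (1 - x) slowness x = sqrt (x (1 - x)) is at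
    most 1/2. *)
Lemma slowness_gap x y : 0 < x -> x <= y -> y < 1 ->
  slowness x + (y - x) / 2 <= slowness y.
Proof.
move=> x0 xy y1; have y0 := lt_le_trans x0 xy; have x1 := le_lt_trans xy y1.
have p0 : 0 <= slowness x + (y - x) / 2.
  by rewrite addr_ge0 ?slowness_ge0// divr_ge0// subr_ge0.
rewrite -(@ler_pXn2r _ 2)//; last by rewrite nnegrE slowness_ge0.
have sx := sqr_slowness x0 x1; have sy := sqr_slowness y0 y1.
have h : slowness x * (1 - x) <= 2^-1.
  rewrite -(@ler_pXn2r _ 2)// ?nnegrE ?mulr_ge0 ?slowness_ge0 ?subr_ge0 ?(ltW x1)//.
  rewrite exprMn sx expr2 mulrA divfK ?gt_eqF ?subr_gt0// -subr_ge0.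
  have -> : 2^-1 ^+ 2 - x * (1 - x) = (x - 2^-1) ^+ 2 by field.
  exact: sqr_ge0.
rewrite sqrrD sx sy.
have h1x : 1 - x != 0 by rewrite gt_eqF ?subr_gt0.
have h1y : 1 - y != 0 by rewrite gt_eqF ?subr_gt0.
have -> : y / (1 - y) = x / (1 - x) + (y - x) / ((1 - x) * (1 - y)) by field; rewrite ?h1x ?h1y.
rewrite -addrA lerD2l.
have sxx : slowness x <= 2^-1 / (1 - x) by rewrite ler_pdivlMr// subr_gt0.
have k1 : 1 / 4 <= 2^-1 / (1 - x) :> R by rewrite ler_pdivlMr ?subr_gt0//; lra.
have k2 : 1 / (1 - x) <= 1 / ((1 - x) * (1 - y)).
  rewrite !div1r lef_pV2 ?posrE ?mulr_gt0 ?subr_gt0//.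
  by rewrite ger_pMr ?subr_gt0//; lra.
apply: (@le_trans _ _ ((y - x) * (1 / (1 - x)))); last first.
  by rewrite -[leRHS]/((y - x) * _) -[X in _ <= _ * X]div1r ler_wpM2l// subr_ge0.
have -> : slowness x * ((y - x) / 2) *+ 2 + ((y - x) / 2) ^+ 2 =
  (y - x) * (slowness x + (y - x) / 4) by field.
rewrite ler_wpM2l ?subr_ge0//.
have -> : 1 / (1 - x) = 2^-1 / (1 - x) + 2^-1 / (1 - x) by field.
by apply: lerD => //; apply: le_trans k1; lra.
Qed.

Lemma slowness_le x y : 0 < x -> x <= y -> y < 1 -> slowness x <= slowness y.
Proof.
by move=> x0 xy y1; apply: le_trans (slowness_gap x0 xy y1); rewrite lerDl divr_ge0 ?subr_ge0.
Qed.

End slowness_facts.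

(** * An admissible curve of finite time *)

Section lipschitz.
Context {R : realType}.
Notation mu := (@lebesgue_measure R).

Lemma ac_line_derive01 (f df : R -> R) (K : R) :
  (forall x, is_derive x (1:R) f (df x)) ->
  (forall x, 0 <= x <= 1 -> `|df x| <= K) -> ac_line (f \o clamp01).
Proof.
move=> fdf dfK; apply: (@ac_line_lipschitz _ _ K) => x y xy /=.
have cxy := clamp01_nd xy.
have cf : continuous f by move=> z; apply: differentiable_continuous; apply/derivable1_diffP.
have [|c cxcy ->] := @MVT_segment R f df (clamp01 x) (clamp01 y) cxy (fun z _ => fdf z).
  by apply: continuous_subspaceT.
move: cxcy; rewrite in_itv/= => /andP[c1 c2].
have K0 : `|df c| <= K.
  by rewrite dfK// (le_trans (clamp01_ge0 _) c1)/= (le_trans c2 (clamp01_le1 _)).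
have K00 : 0 <= K by rewrite (le_trans _ K0).
rewrite normrM [X in _ * X]ger0_norm ?subr_ge0// ler_pM ?subr_ge0//.
exact: clamp01_lip.
Qed.

End lipschitz.

Section finite_time.
Context {R : realType}.
Notation mu := (@lebesgue_measure R).

Lemma enorm_polar (r t : R) : 0 <= r -> enorm (polar r t) = r.
Proof.
move=> r0; rewrite /enorm /dot /polar/=.
rewrite (_ : _ + _ = r ^+ 2 * (cos t ^+ 2 + sin t ^+ 2)); last ring.
by rewrite cos2Dsin2 mulr1 sqrtr_sqr ger0_norm.
Qed.

(** The slowness is infinite at the starting point, and at the end point when
    r = 1. In the polar curve below, 1 - rho = w vanishes there to second order
    and the derivatives of rho and theta to first order, so the squared speed
    is at most a multiple of w, which compensates slowness^2 <= 1 / w. *)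
Lemma exists_finite_time (eps r : R) : 0 < eps < 1 -> eps <= r <= 1 ->
  exists b, admissible_off eps (polar r pi) b /\ (time_of_flight b < +oo)%E.
Proof.
move=> /andP[e0 e1] /andP[er r1].
pose w (s : R) : R := (1 - r) * s ^+ 2 + (1 - eps) * (s ^+ 2 * (1 - s) ^+ 2).
pose rho (s : R) : R := 1 - w s.
pose drho (s : R) : R := - (2 * (1 - r) * s + 2 * (1 - eps) * (s * (1 - s) * (1 - 2 * s))).
pose theta (s : R) : R := pi * (3 * s ^+ 2 - 2 * s ^+ 3).
pose dtheta (s : R) : R := pi * (6 * (s * (1 - s))).
pose b s := polar (rho s) (theta s).
have Drho (s : R) : is_derive s (1:R) rho (drho s).
  rewrite /rho /w; apply: is_derive_eq; rewrite /GRing.scale/= /drho.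
  by ring.
have Dtheta (s : R) : is_derive s (1:R) theta (dtheta s).
  rewrite /theta; apply: is_derive_eq; rewrite /GRing.scale/= /dtheta.
  by ring.
have DX (s : R) : is_derive s (1:R) (fst \o b)
    (drho s * cos (theta s) - rho s * sin (theta s) * dtheta s).
  have -> : fst \o b = rho * (cos \o theta) by [].
  by apply: is_derive_eq; rewrite /GRing.scale/=; ring.
have DY (s : R) : is_derive s (1:R) (snd \o b)
    (drho s * sin (theta s) + rho s * cos (theta s) * dtheta s).
  have -> : snd \o b = rho * (sin \o theta) by [].
  by apply: is_derive_eq; rewrite /GRing.scale/=; ring.
have vb s : enorm (velocity b s) ^+ 2 = drho s ^+ 2 + rho s ^+ 2 * dtheta s ^+ 2.
  rewrite sqr_enorm /velocity/= !derive1E !derive_val.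
  have cs := cos2Dsin2 (theta s).
  have -> : drho s ^+ 2 + rho s ^+ 2 * dtheta s ^+ 2 =
     (drho s ^+ 2 + rho s ^+ 2 * dtheta s ^+ 2) * (cos (theta s) ^+ 2 + sin (theta s) ^+ 2).
    by rewrite cs mulr1.
  by ring.
have w_le (s : R) : 0 <= s <= 1 -> 0 <= w s <= 1 - eps.
  move=> /andP[s0 s1]; rewrite /w; apply/andP; split.
    by rewrite addr_ge0// !mulr_ge0// ?subr_ge0 ?sqr_ge0// ltW.
  have h1 : (1 - r) * s ^+ 2 <= (1 - eps) * s ^+ 2.
    by rewrite ler_wpM2r ?sqr_ge0//; lra.
  apply: le_trans (lerD h1 (lexx _)) _; rewrite -mulrDr ger_pMr ?subr_gt0//.
  rewrite -subr_ge0; have -> : 1 - (s ^+ 2 + s ^+ 2 * (1 - s) ^+ 2) =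
    (1 - s) * (1 + s - s * (s * (1 - s))) by ring.
  apply: mulr_ge0; first lra.
  have : s * (s * (1 - s)) <= s by rewrite ler_piMr// mulr_ile1//; lra.
  lra.
pose C2 : R := 8 + 36 * pi ^+ 2 / (1 - eps).
have C20 : 0 <= C2 by rewrite addr_ge0// divr_ge0//; [rewrite mulr_ge0// sqr_ge0|rewrite subr_ge0 ltW].
have vC2 (s : R) : 0 <= s <= 1 -> enorm (velocity b s) ^+ 2 <= C2 * w s.
  move=> s01; have /andP[w0 w1] := w_le s s01; have /andP[s0 s1] := s01.
  rewrite vb.
  have r2 : rho s ^+ 2 <= 1.
    by rewrite expr_le1// /rho; lra.
  have h1 : drho s ^+ 2 <= 8 * w s.
    rewrite /drho sqrrN.
    pose A := (1 - r) * s; pose E := (1 - eps) * (s * (1 - s)).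
    have -> : 2 * (1 - r) * s + 2 * (1 - eps) * (s * (1 - s) * (1 - 2 * s)) =
      2 * (A + E * (1 - 2 * s)) by rewrite /A /E; ring.
    have A2 : A ^+ 2 <= (1 - r) * s ^+ 2.
      by rewrite /A exprMn ler_wpM2r ?sqr_ge0// expr2 ler_piMr//; lra.
    have E2 : E ^+ 2 <= (1 - eps) * (s ^+ 2 * (1 - s) ^+ 2).
      have k0 : 0 <= s ^+ 2 * (1 - s) ^+ 2 by rewrite mulr_ge0 ?sqr_ge0.
      rewrite /E exprMn (exprMn 2 s); apply: ler_wpM2r => //.
      by rewrite expr2 ler_piMr//; lra.
    have E3 : (E * (1 - 2 * s)) ^+ 2 <= E ^+ 2.
      rewrite exprMn ler_piMr ?sqr_ge0// -subr_ge0.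
      by rewrite (_ : _ - _ = 4 * (s * (1 - s))) ?mulr_ge0//; [lra|ring].
    have := sqr_ge0 (A - E * (1 - 2 * s)); rewrite /w; nra.
  have h2 : rho s ^+ 2 * dtheta s ^+ 2 <= 36 * pi ^+ 2 / (1 - eps) * w s.
    have h3 : (1 - eps) * (s * (1 - s)) ^+ 2 <= w s.
      by rewrite /w exprMn lerDr mulr_ge0 ?sqr_ge0// subr_ge0.
    apply: (@le_trans _ _ (dtheta s ^+ 2)).
      by rewrite ler_piMl// sqr_ge0.
    have -> : dtheta s ^+ 2 = 36 * pi ^+ 2 / (1 - eps) * ((1 - eps) * (s * (1 - s)) ^+ 2).
      by rewrite /dtheta; field; rewrite gt_eqF ?subr_gt0.
    rewrite ler_wpM2l// divr_ge0//; first by rewrite mulr_ge0// sqr_ge0.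
    by rewrite subr_ge0 ltW.
  by rewrite /C2 mulrDl lerD.
pose C := Num.sqrt C2.
have vC (s : R) : 0 <= s <= 1 -> enorm (velocity b s) <= C.
  move=> s01; have /andP[w0 w1] := w_le s s01.
  rewrite -(@ler_pXn2r _ 2)// ?nnegrE ?enorm_ge0 ?sqrtr_ge0// (sqr_sqrtr C20).
  by apply: le_trans (vC2 s s01) _; rewrite ler_piMr//; lra.
have aX : ac_line (fst \o b \o clamp01).
  apply: (ac_line_derive01 DX) => s s01; apply: le_trans (vC s s01).
  have <- : (velocity b s).1 = drho s * cos (theta s) - rho s * sin (theta s) * dtheta s.
    by rewrite /velocity/= derive1E (@derive_val _ _ _ _ _ _ _ (DX s)).
  exact: fst_le_enorm.
have aY : ac_line (snd \o b \o clamp01).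
  apply: (ac_line_derive01 DY) => s s01; apply: le_trans (vC s s01).
  have <- : (velocity b s).2 = drho s * sin (theta s) + rho s * cos (theta s) * dtheta s.
    by rewrite /velocity/= derive1E (@derive_val _ _ _ _ _ _ _ (DY s)).
  exact: snd_le_enorm.
have acb : abs_continuous01 b.
  by apply: abs_continuous01_coords aX aY _ => s /andP[s0 s1] /=; rewrite clamp01_id.
have nb (s : R) : 0 <= s <= 1 -> enorm (b s) = rho s.
  move=> s01; have /andP[w0 w1] := w_le s s01.
  by rewrite enorm_polar// /rho; lra.
have rho_itv (s : R) : 0 <= s <= 1 -> eps <= rho s <= 1.
  by move=> s01; have /andP[w0 w1] := w_le s s01; rewrite /rho; lra.
exists b; split; [split; [split|]|] => //.
- rewrite /b /polar /rho /theta /w.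
  by rewrite !expr0n/= !(mul0r, mulr0) subr0 mulr0 addr0 subr0 cos0 sin0 mulr1 mulr0.
- rewrite /b /polar /rho /theta /w.
  rewrite !expr1n subrr expr0n/= !(mulr0, mulr1) addr0 opprB addrC subrK.
  by rewrite (_ : 3 - 2 = 1) ?mulr1//; ring.
- by move=> s s01; rewrite nb//; have /andP[] := rho_itv s s01.
- by move=> s s01; rewrite nb//; have /andP[] := rho_itv s s01.
have mb : measurable_fun (`]0, 1[%classic : set R) (time_density b).
  apply: measurable_time_density => // s s01; rewrite nb//.
  by have /andP[/(lt_le_trans e0) -> ->] := rho_itv s s01.
rewrite time_of_flight_oo//.
apply: (@le_lt_trans _ _ (\int[mu]_(s in `]0%R, 1%R[) C%:E)%E); last first.
  by rewrite integral_cst//= lebesgue_measure_itv/= lte_fin ltr01 oppr0 adde0 mule1 ltry.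
apply: ge0_le_integral => //.
- by move=> s _; exact: time_density_ge0.
move=> s /=; rewrite in_itv/= => /andP[s0 s1].
have s01 : 0 <= s <= 1 by rewrite !ltW.
have /andP[r0 _] := rho_itv s s01.
have w0 : 0 < w s.
  have k1 : 0 <= (1 - r) * s ^+ 2 by rewrite mulr_ge0 ?sqr_ge0// subr_ge0.
  have k2 : 0 < s ^+ 2 * (1 - s) ^+ 2 by rewrite mulr_gt0// exprn_gt0// subr_gt0.
  by rewrite /w ltr_wpDl// mulr_gt0// subr_gt0.
have rp : 0 < rho s by exact: lt_le_trans r0.
have r1' : rho s < 1 by rewrite /rho; lra.
rewrite time_densityE nb// lee_fin.
rewrite -(@ler_pXn2r _ 2)// ?nnegrE ?mulr_ge0 ?enorm_ge0 ?slowness_ge0 ?sqrtr_ge0//.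
rewrite (sqr_sqrtr C20) exprMn sqr_slowness//.
have -> : 1 - rho s = w s by rewrite /rho; ring.
rewrite mulrA ler_pdivrMr//.
apply: (@le_trans _ _ (enorm (velocity b s) ^+ 2)); last exact: vC2.
by rewrite ler_piMr ?sqr_ge0// ltW.
Qed.

End finite_time.

(** * A minimizer touches the obstacle *)

Section contact.
Context {R : realType}.
Implicit Types (a b : R -> R * R).
Notation mu := (@lebesgue_measure R).

(** No derivability is assumed: where f has no derivative neither does c f, and
    both sides are the default value 0. *)
Lemma derive1_scale (c : R) (f : R -> R) (x : R) : c != 0 ->
  (fun t => c * f t)^`()%classic x = c * f^`()%classic x.
Proof.
move=> c0.
have [df|nf] := pselect (derivable f x 1).
  have -> : (fun t => c * f t) = c \*: f by [].
  by rewrite !derive1E deriveZ.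
have nd (g : R -> R) : ~ derivable g x 1 -> g^`()%classic x = 0.
  move=> ng; rewrite derive1E /derive; exact: (dvgP ng).
rewrite (nd f nf) mulr0; apply: nd => dcf; apply: nf.
have -> : f = c^-1 \*: (fun t => c * f t).
  by apply/funext => t /=; rewrite /GRing.scale/= mulKf.
exact: derivableZ.
Qed.

Lemma last_time_le (g : R -> R) (c u v : R) : continuous g -> u <= v -> g u <= c ->
  exists t, [/\ u <= t, t <= v, g t <= c & forall s, t < s -> s <= v -> c < g s].
Proof.
move=> cg uv gu.
pose A := [set s | u <= s /\ s <= v /\ g s <= c].
have A0 : A !=set0 by exists u.
have ubA : ubound A v by move=> s [_ []].
have cA : closed A.
  have -> : A = [set s | u <= s] `&` ([set s | s <= v] `&` (g @^-1` [set y | y <= c])) by [].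
  apply: closedI; first exact: closed_ge.
  apply: closedI; first exact: closed_le.
  by apply: preimage_closed; [move=> x _; exact: cg|exact: closed_le].
have hA : has_sup A by split => //; exists v.
have : A (sup A) by apply: cA; apply: closure_sup => //; exists v.
move=> [us [sv gs]]; exists (sup A); split => // s ss sv'.
rewrite ltNge; apply/negP => gsc.
have : s <= sup A by apply: ub_le_sup; [exists v|split => //; apply: le_trans us (ltW ss)].
by rewrite leNgt ss.
Qed.

Lemma minimizer_finite eps (r : R) a : 0 < eps < 1 -> eps <= r <= 1 ->
  minimizer (admissible_off eps (polar r pi)) a -> (time_of_flight a < +oo)%E.
Proof.
move=> e01 r01 [_ amin]; have [b [bA bfin]] := exists_finite_time e01 r01.
exact: le_lt_trans (amin _ bA) bfin.
Qed.

Lemma integral_density_ge0 a (D : set R) : (0 <= \int[mu]_(s in D) time_density a s)%E.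
Proof. by apply: integral_ge0 => s _; exact: time_density_ge0. Qed.

(** A contraction towards the axis that carries both end points of the curves,
    hence leaves these fixed. *)
Definition flatten (l : R) (p : R * R) : R * R := (p.1, l * p.2).

Lemma sqr_enorm_flatten l p : enorm (flatten l p) ^+ 2 = p.1 ^+ 2 + l ^+ 2 * p.2 ^+ 2.
Proof. by rewrite sqr_enorm exprMn. Qed.

Lemma enorm_flatten_le l p : 0 <= l -> l <= 1 -> enorm (flatten l p) <= enorm p.
Proof.
move=> l0 l1; rewrite -(@ler_pXn2r _ 2)// ?nnegrE ?enorm_ge0//.
by rewrite sqr_enorm_flatten sqr_enorm lerD2l ler_piMl ?sqr_ge0// expr_le1.
Qed.

Lemma enorm_flatten_ge l p : 0 <= l -> l <= 1 -> l * enorm p <= enorm (flatten l p).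
Proof.
move=> l0 l1; rewrite -(@ler_pXn2r _ 2)// ?nnegrE ?mulr_ge0 ?enorm_ge0//.
rewrite exprMn sqr_enorm_flatten sqr_enorm mulrDr lerD2r.
by rewrite ler_piMl ?sqr_ge0// expr_le1.
Qed.

Lemma ac_flatten l a : 0 <= l -> l <= 1 ->
  abs_continuous01 a -> abs_continuous01 (flatten l \o a).
Proof.
move=> l0 l1 aca.
have ac2 : ac_line ((fun p : R * R => l * p.2) \o a \o clamp01).
  apply: ac_line_clamp => // p q; rewrite -mulrBr normrM ger0_norm//.
  by apply: le_trans (snd_le_enorm (p - q)); rewrite ler_piMl.
apply: abs_continuous01_coords (ac_line_fst aca) ac2 _ => s /andP[s0 s1] /=.
by rewrite clamp01_id.
Qed.

Lemma velocity_flatten l a s : l != 0 -> velocity (flatten l \o a) s = flatten l (velocity a s).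
Proof.
move=> l0; rewrite /velocity /flatten/=; congr pair.
by rewrite -derive1_scale.
Qed.

(** Flattening does not increase the speed; it decreases the radius from A to
    B with A^2 - B^2 = (1 - l^2) y^2, and then [slowness_gap] gives the gain
    (A - B) / 2 >= (A^2 - B^2) / 4. *)
Lemma flatten_density_le l a s : 0 < l -> l <= 1 -> 0 < enorm (a s) -> enorm (a s) <= 1 ->
  (time_density (flatten l \o a) s +
     (enorm (velocity a s) * ((1 - l ^+ 2) * (a s).2 ^+ 2 / 4))%:E
    <= time_density a s)%E.
Proof.
move=> l0 l1 a0 a1.
have v_le : enorm (velocity (flatten l \o a) s) <= enorm (velocity a s).
  by rewrite velocity_flatten ?gt_eqF// enorm_flatten_le// ltW.
have [v0|v0] := eqVneq (enorm (velocity a s)) 0.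
  rewrite v0 mul0r adde0 {1}/time_density.
  have -> : enorm (velocity (flatten l \o a) s) = 0.
    by apply/eqP; rewrite eq_le enorm_ge0 -v0 v_le.
  by rewrite mul0e time_density_ge0.
have vp : 0 < enorm (velocity a s) by rewrite lt_neqAle eq_sym v0 enorm_ge0.
have [a_1|a_1] := eqVneq (enorm (a s)) 1.
  by rewrite (time_density1 a_1) gt0_muley ?leey.
have a_lt1 : enorm (a s) < 1 by rewrite lt_neqAle a_1.
have b0 : 0 < enorm ((flatten l \o a) s).
  by apply: lt_le_trans (enorm_flatten_ge _ (ltW l0) l1); rewrite mulr_gt0.
have ba : enorm ((flatten l \o a) s) <= enorm (a s) by rewrite enorm_flatten_le// ltW.
rewrite !time_densityE//; last by exact: le_lt_trans a_lt1.
rewrite -EFinD lee_fin.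
apply: (@le_trans _ _ (enorm (velocity a s) * slowness (enorm ((flatten l \o a) s)) +
   enorm (velocity a s) * ((1 - l ^+ 2) * (a s).2 ^+ 2 / 4))).
  by rewrite lerD2r ler_wpM2r// slowness_ge0.
rewrite -mulrDr ler_wpM2l// ?enorm_ge0//.
apply: le_trans (slowness_gap b0 ba a_lt1); rewrite lerD2l.
have := sqr_enorm (a s); have := sqr_enorm_flatten l (a s).
rewrite -/((flatten l \o a) s); move: ba a_lt1 b0 a0.
move: (enorm ((flatten l \o a) s)) (enorm (a s)) => B A BA A1 B0 A0 EB EA.
have -> : (1 - l ^+ 2) * (a s).2 ^+ 2 = (A - B) * (A + B).
  by rewrite -subr_sqr EB EA; ring.
nra.
Qed.

Lemma time_of_flight_ge0 a : (0 <= time_of_flight a)%E.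
Proof. exact: integral_density_ge0. Qed.

(** Stated for abstract values so that no proof has to unfold the two times of
    flight to which it applies. *)
Lemma no_gain (x y : \bar R) (c : R) :
  (0 <= y -> x < +oo -> x <= y -> y + c%:E <= x -> (c <= 0)%R)%E.
Proof.
move: x y => [x||] [y||] // y0 _; rewrite -?EFinD ?lee_fin; first lra.
Qed.

Lemma time_gain a b (u v c : R) : 0 <= u -> u <= v -> v <= 1 -> abs_continuous01 a ->
  measurable_fun (`]0, 1[%classic : set R) (time_density a) ->
  measurable_fun (`]0, 1[%classic : set R) (time_density b) -> 0 <= c ->
  (forall s, 0 < s -> s < 1 -> (time_density b s <= time_density a s)%E) ->
  (forall s, u < s -> s < v ->
    (time_density b s + (c * enorm (velocity a s))%:E <= time_density a s)%E) ->
  (time_of_flight b + (c * enorm (a v - a u))%:E <= time_of_flight a)%E.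
Proof.
move=> u0 uv v1 aca ma mb c0 ba bac.
have sub01 : `]u, v[ `<=` `]0, 1[.
  by move=> x /=; rewrite !in_itv/= => /andP[/(le_lt_trans u0) -> /lt_le_trans ->].
have m01 : measurable (`]0, 1[%classic : set R) by exact: measurable_itv.
have mJ : measurable (`]u, v[%classic : set R) by exact: measurable_itv.
have mout : measurable (outside u v) by exact: measurableD.
have sout : outside u v `<=` `]0, 1[ by exact: subDsetl.
have mJb : measurable_fun `]u, v[ (time_density b) by exact: measurable_funS mb.
have mv : measurable_fun `]u, v[ (fun s => (c * enorm (velocity a s))%:E).
  apply/measurable_EFinP; apply: measurable_funM; first exact: measurable_cst.
  exact: (measurable_funS m01 sub01 (measurable_speed aca)).
rewrite (time_of_flight_split u0 uv v1 mb) (time_of_flight_split u0 uv v1 ma) -addeA.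
apply: leeD.
  apply: ge0_le_integral.
  - exact: mout.
  - by move=> s _; exact: time_density_ge0.
  - exact: measurable_funS mb.
  - exact: measurable_funS ma.
  - by move=> s /sout; rewrite /= in_itv/= => /andP[s0 s1]; exact: ba.
apply: (@le_trans _ _ (\int[mu]_(s in `]u, v[) (time_density b s + (c * enorm (velocity a s))%:E))%E).
  rewrite ge0_integralD//.
  - apply: leeD2l; rewrite EFinM.
    apply: (@le_trans _ _ (c%:E * \int[mu]_(s in `]u, v[) (enorm (velocity a s))%:E)%E).
      by apply: lee_wpmul2l; rewrite ?lee_fin//; exact: chord_le_length.
    rewrite -ge0_integralZl//.
    + by apply/measurable_EFinP; exact: (measurable_funS m01 sub01 (measurable_speed aca)).
    + by move=> s _; rewrite lee_fin enorm_ge0.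
  - by move=> s _; exact: time_density_ge0.
  - by move=> s _; rewrite lee_fin mulr_ge0// enorm_ge0.
apply: ge0_le_integral.
- exact: mJ.
- by move=> s _; rewrite adde_ge0// ?time_density_ge0// lee_fin mulr_ge0// enorm_ge0.
- exact: emeasurable_funD.
- exact: measurable_funS ma.
- by move=> s; rewrite /= in_itv/= => /andP[us sv]; exact: bac.
Qed.

(** If the least distance m to the origin exceeded eps, flattening by the factor
    eps / m would stay outside the obstacle, keep the end points and take
    strictly less time. *)
Lemma contact_exists (eps r : R) a : 0 < eps < 1 -> eps <= r <= 1 ->
  minimizer (admissible_off eps (polar r pi)) a ->
  exists2 s, 0 <= s <= 1 & enorm (a s) = eps.
Proof.
move=> e01 r01 amin; have Tfin := minimizer_finite e01 r01 amin.
have [e0 e1] := andP e01; have [er r1] := andP r01.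
have [[[aca a_0 a_1 a_le1] a_ge] aleast] := amin.
apply: contrapT => nocontact.
pose X s := (a (clamp01 s)).1; pose Y s := (a (clamp01 s)).2.
have cX : continuous X by exact: continuous_fst.
have cY : continuous Y by exact: continuous_snd.
have cN : continuous (fun s => enorm (a (clamp01 s))) by exact: continuous_enorm.
have c01 (s : R) : 0 <= clamp01 s <= 1 by rewrite clamp01_ge0 clamp01_le1.
have [sm sm01 smin] := @EVT_min R _ 0 1 ler01 (continuous_subspaceT cN).
pose m := enorm (a (clamp01 sm)).
have em : eps < m.
  rewrite lt_neqAle (a_ge _ (c01 sm)) andbT; apply/eqP => em.
  by apply: nocontact; exists (clamp01 sm).
have m0 : 0 < m by exact: lt_trans em.
have mle s : 0 <= s <= 1 -> m <= enorm (a s).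
  move=> /andP[s0 s1]; have := smin s; rewrite in_itv/= s0 s1 (clamp01_id s0 s1); exact.
have a_gt0 s : 0 <= s <= 1 -> 0 < enorm (a s) by move=> s01; exact: lt_le_trans (mle s s01).
pose l := eps / m.
have l0 : 0 < l by rewrite divr_gt0.
have l1 : l < 1 by rewrite ltr_pdivrMr// mul1r.
have ll1 := ltW l1; have ll0 := ltW l0.
pose b := flatten l \o a.
have acb : abs_continuous01 b by exact: ac_flatten.
have b_ge s : 0 <= s <= 1 -> eps <= enorm (b s).
  move=> s01; apply: le_trans (enorm_flatten_ge _ ll0 ll1).
  by rewrite /l mulrAC ler_pdivlMr// ler_pM2l// mle.
have b_le s : 0 <= s <= 1 -> enorm (b s) <= 1.
  by move=> s01; apply: le_trans (enorm_flatten_le _ ll0 ll1) (a_le1 s s01).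
have bA : admissible_off eps (polar r pi) b.
  split => //; split => //.
  - by rewrite /b/= a_0 /flatten/= mulr0.
  - by rewrite /b/= a_1 /flatten /polar/= sinpi !mulr0.
have Tab := aleast _ bA.
have ma : measurable_fun (`]0, 1[%classic : set R) (time_density a).
  by apply: measurable_time_density => // s s01; rewrite a_gt0// a_le1.
have mb : measurable_fun (`]0, 1[%classic : set R) (time_density b).
  by apply: measurable_time_density => // s s01; rewrite (lt_le_trans e0 (b_ge s s01)) b_le.
(* a stretch on which the curve moves and stays away from the horizontal axis:
   from the last time its height is eps / 2 up to a crossing of the vertical
   axis, where its height is its distance to the origin *)
have [sx sx01 Xsx] : exists2 s, s \in `[0, 1] & X s = 0.
  apply: (@IVT R X 0 1 0 ler01); first exact: continuous_subspaceT.
  rewrite /X !clamp01_id// a_0 a_1 /polar/= cospi ge_min le_max.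
  by apply/andP; split; apply/orP; [right|left]; lra.
move: sx01; rewrite in_itv/= => sx01; have [sx0 sx1] := andP sx01.
have Ysx : eps <= `|Y sx|.
  have := a_ge sx sx01; rewrite /Y clamp01_id//.
  have : enorm (a sx) ^+ 2 = (a sx).2 ^+ 2.
    by rewrite sqr_enorm; move: Xsx; rewrite /X clamp01_id// => ->; rewrite expr0n add0r.
  move=> h; suff -> : enorm (a sx) = `|(a sx).2| by [].
  by apply/eqP; rewrite -(@eqrXn2 _ 2)// ?enorm_ge0// h -normrX ger0_norm// sqr_ge0.
have cY' : continuous (fun s => `|Y s|) by move=> s; apply: cvg_norm; exact: cY.
have Y0 : `|Y 0| <= eps / 2 by rewrite /Y clamp01_id// a_0/= normr0 divr_ge0// ltW.
have [t [t0 tsx Yt tlast]] := last_time_le cY' sx0 Y0.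
pose c := (1 - l ^+ 2) * (eps / 2) ^+ 2 / 4.
have c0 : 0 < c.
  by rewrite /c !mulr_gt0 ?exprn_gt0 ?invr_gt0 ?divr_gt0// subr_gt0 expr_lt1.
have tsx1 := le_trans tsx sx1.
have Lp : 0 < enorm (a sx - a t).
  apply: lt_le_trans (snd_le_enorm _) => /=.
  move: Ysx Yt; rewrite /Y !clamp01_id// => Ysx Yt.
  have := ler_dist_dist (a sx).2 (a t).2; have := ler_norm (`|(a sx).2| - `|(a t).2|); lra.
have Tba : (time_of_flight b + (c * enorm (a sx - a t))%:E <= time_of_flight a)%E.
  apply: (time_gain t0 tsx sx1 aca ma mb (ltW c0)).
    move=> s s0 s1; have s01 : 0 <= s <= 1 by rewrite (ltW s0) (ltW s1).
    apply: le_trans (flatten_density_le l0 ll1 (a_gt0 s s01) (a_le1 s s01)).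
    rewrite leeDl// lee_fin mulr_ge0 ?enorm_ge0// divr_ge0// mulr_ge0 ?sqr_ge0//.
    by rewrite subr_ge0 expr_le1.
  move=> s ts ssx; have s01 : 0 <= s <= 1.
    by rewrite (le_trans t0 (ltW ts)) (le_trans (ltW ssx) sx1).
  apply: le_trans (flatten_density_le l0 ll1 (a_gt0 s s01) (a_le1 s s01)).
  rewrite leeD2l// lee_fin mulrC ler_wpM2l ?enorm_ge0//.
  have := tlast s ts (ltW ssx); rewrite /Y clamp01_id ?(andP s01).1 ?(andP s01).2// => Ys.
  rewrite /c ler_pM2r// ler_wpM2l//; first by rewrite subr_ge0 expr_le1.
  rewrite -[leRHS]ger0_norm ?sqr_ge0// normrX ler_pXn2r// ?nnegrE ?divr_ge0 ?(ltW e0)//.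
  exact: ltW.
have cL : 0 < c * enorm (a sx - a t) by rewrite mulr_gt0.
have := no_gain (time_of_flight_ge0 b) Tfin Tab Tba.
by rewrite leNgt cL.
Qed.

End contact.

(** * Replacing an arc by its chord *)

Section shortcut.
Context {R : realType}.
Implicit Types (a b : R -> R * R).
Notation mu := (@lebesgue_measure R).

Definition chord (p q : R * R) (l : R) : R * R :=
  (p.1 + l * (q.1 - p.1), p.2 + l * (q.2 - p.2)).

Definition shortcut a (u v s : R) : R * R :=
  if u < s < v then chord (a u) (a v) ((s - u) / (v - u)) else a s.

(** A coordinate X of the curve, made affine between u and v. Writing the
    case distinction of [shortcut] as a sum of X composed with truncations and
    of a piecewise affine function makes absolute continuity a closure
    property. *)
Let spliced (X : R -> R) (u v s : R) : R :=
  X (Num.min s u)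
  + ((Num.max u (Num.min s v) - u) / (v - u) * (X v - X u) - X v)
  + X (Num.max s v).

Let ac_spliced (X : R -> R) (u v : R) : ac_line X -> u < v ->
  ac_line (spliced X u v).
Proof.
move=> acX uv; have vu : 0 < v - u by rewrite subr_gt0.
pose lin (s : R) :=
  (Num.max u (Num.min s v) - u) / (v - u) * (X v - X u) - X v.
pose low (s : R) := X (Num.min s u).
apply: (@ac_lineD _ (low \+ lin) (fun s => X (Num.max s v))).
  apply: (@ac_lineD _ low lin).
    apply: (@ac_line_comp _ X (fun s => Num.min s u)) => // x y xy.
      by case: (leP x u) => ?; case: (leP y u) => ?; lra.
    by case: (leP x u) => ?; case: (leP y u) => ?; lra.
  apply: (@ac_line_lipschitz _ _ ((v - u)^-1 * `|X v - X u|)) => x y xy.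
  rewrite /lin.
  set M := Num.max u (Num.min x v); set M' := Num.max u (Num.min y v).
  have -> : (M' - u) / (v - u) * (X v - X u) - X v - ((M - u) / (v - u) * (X v - X u) - X v) =
    ((v - u)^-1 * (X v - X u)) * (M' - M) by ring.
  rewrite normrM normrM (ger0_norm (x := (v - u)^-1)) ?invr_ge0 ?(ltW vu)//.
  rewrite ler_wpM2l ?mulr_ge0 ?invr_ge0 ?(ltW vu)//.
  rewrite ler_norml /M /M'.
  by case: (leP x v) => ?; case: (leP y v) => ?; rewrite ?(max_r (ltW uv));
    try (case: (leP u x) => ?); try (case: (leP u y) => ?); apply/andP; split; lra.
apply: (@ac_line_comp _ X (fun s => Num.max s v)) => // x y xy.
  by case: (leP x v) => ?; case: (leP y v) => ?; lra.
by case: (leP x v) => ?; case: (leP y v) => ?; lra.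
Qed.

Let splicedE (X : R -> R) (u v s : R) : u < v -> spliced X u v s =
  if u < s < v then X u + (s - u) / (v - u) * (X v - X u) else X s.
Proof.
move=> uv; have vu : v - u != 0 by rewrite gt_eqF ?subr_gt0.
rewrite /spliced; have [us|su]/= := ltP u s.
  have [sv|vs] := ltP s v.
    rewrite (max_r (ltW us)); ring.
  rewrite (max_r (ltW uv)) divff//; ring.
rewrite (min_l (le_trans su (ltW uv))) (max_l su) (max_r (le_trans su (ltW uv))).
ring.
Qed.

Lemma ac_shortcut a (u v : R) : abs_continuous01 a -> 0 <= u -> u < v -> v <= 1 ->
  abs_continuous01 (shortcut a u v).
Proof.
move=> aca u0 uv v1.
have u1 := le_trans (ltW uv) v1; have v0 := le_trans u0 (ltW uv).
have aX := ac_spliced (ac_line_fst aca) uv.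
have aY := ac_spliced (ac_line_snd aca) uv.
apply: (abs_continuous01_coords aX aY) => s /andP[s0 s1].
rewrite !splicedE// /shortcut /chord/= !clamp01_id//.
by case: ifP => // _; exact: surjective_pairing.
Qed.

Lemma near_inside (u v s : R) : u < s -> s < v -> \forall t \near s, u < t < v.
Proof.
move=> us sv; near=> t; apply/andP; split.
  by near: t; exact: lt_nbhsr.
by near: t; exact: lt_nbhsl.
Unshelve. all: by end_near. Qed.

Lemma velocity_shortcut_in a (u v s : R) : u < s -> s < v ->
  enorm (velocity (shortcut a u v) s) = enorm (a v - a u) / (v - u).
Proof.
move=> us sv; have vu : 0 < v - u by rewrite subr_gt0 (lt_trans us).
have -> : velocity (shortcut a u v) s = velocity (fun t => chord (a u) (a v) ((t - u) / (v - u))) s.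
  apply: near_eq_velocity; apply: filterS (near_inside us sv) => t tuv.
  by rewrite /shortcut tuv.
have D (x d : R) : (fun t : R => x + (t - u) / (v - u) * d)^`()%classic s = d / (v - u).
  rewrite derive1E.
  have -> : (fun t : R => x + (t - u) / (v - u) * d) = (cst x \+ ((d / (v - u)) \*: (id \- cst u))).
    by apply/funext => t /=; rewrite /GRing.scale/=; ring.
  by rewrite derive_val /GRing.scale/=; ring.
rewrite /velocity /chord.
rewrite [X in enorm (X, _)](D (a u).1 ((a v).1 - (a u).1)).
rewrite [X in enorm (_, X)](D (a u).2 ((a v).2 - (a u).2)).
rewrite /enorm /dot/=.
set x := (a v).1 - _; set y := (a v).2 - _.
have -> : x / (v - u) * (x / (v - u)) + y / (v - u) * (y / (v - u)) = (x * x + y * y) * (v - u)^-1 ^+ 2 by ring.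
by rewrite sqrtrM ?addr_ge0 -?expr2 ?sqr_ge0// sqrtr_sqr ger0_norm// invr_ge0 ltW.
Qed.

Lemma density_shortcut_out a (u v s : R) : (s < u) || (v < s) ->
  time_density (shortcut a u v) s = time_density a s.
Proof.
move=> suv.
have nr : \forall t \near s, shortcut a u v t = a t.
  case/orP: suv => h; near=> t.
    rewrite /shortcut; have -> : u < t = false.
      by apply/negbTE; rewrite -leNgt ltW//; near: t; exact: lt_nbhsl.
    by [].
  rewrite /shortcut; have -> : t < v = false.
    by apply/negbTE; rewrite -leNgt ltW//; near: t; exact: lt_nbhsr.
  by rewrite andbF.
by rewrite /time_density (near_eq_velocity nr) (nbhs_singleton nr).
Unshelve. all: by end_near. Qed.

(** On the annulus the slowness is least on the obstacle, and the length of an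
    arc is at least that of its chord. *)
Lemma chord_time_le a (eps u v : R) : abs_continuous01 a -> 0 < eps < 1 ->
  (forall s, 0 <= s <= 1 -> eps <= enorm (a s) <= 1) ->
  measurable_fun (`]0, 1[%classic : set R) (time_density a) ->
  0 <= u -> u <= v -> v <= 1 ->
  ((slowness eps * enorm (a v - a u))%:E <= \int[mu]_(s in `]u, v[) time_density a s)%E.
Proof.
move=> aca /andP[e0 e1] a01 ma u0 uv v1.
have sub01 : `]u, v[ `<=` `]0, 1[.
  by move=> x /=; rewrite !in_itv/= => /andP[/(le_lt_trans u0) -> /lt_le_trans ->].
have m01 : measurable (`]0, 1[%classic : set R) by exact: measurable_itv.
have mJ : measurable (`]u, v[%classic : set R) by exact: measurable_itv.
have ms := measurable_funS m01 sub01 (measurable_speed aca).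
have sl0 := slowness_ge0 eps.
apply: (@le_trans _ _ (\int[mu]_(s in `]u, v[) ((slowness eps)%:E * (enorm (velocity a s))%:E))%E).
  rewrite ge0_integralZl//.
  - by rewrite EFinM; apply: lee_wpmul2l; rewrite ?lee_fin//; exact: chord_le_length.
  - exact/measurable_EFinP.
  - by move=> s _; rewrite lee_fin enorm_ge0.
apply: ge0_le_integral.
- exact: mJ.
- by move=> s _; rewrite mule_ge0// lee_fin ?enorm_ge0.
- by apply: emeasurable_funM; [exact: measurable_cst|exact/measurable_EFinP].
- exact: (measurable_funS m01 sub01 ma).
move=> s /sub01; rewrite /= in_itv/= => /andP[s0 s1].
have s01 : 0 <= s <= 1 by rewrite (ltW s0) (ltW s1).
have /andP[ea a1] := a01 s s01.
rewrite -EFinM; have [a_1|a_1] := eqVneq (enorm (a s)) 1.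
  rewrite (time_density1 a_1).
  have [->|v0] := eqVneq (enorm (velocity a s)) 0; first by rewrite mulr0 mul0e.
  by rewrite gt0_muley ?leey// lte_fin lt_neqAle eq_sym v0 enorm_ge0.
have a_lt1 : enorm (a s) < 1 by rewrite lt_neqAle a_1.
rewrite time_densityE//; last exact: lt_le_trans ea.
by rewrite lee_fin mulrC ler_wpM2l ?enorm_ge0// slowness_le.
Qed.

Lemma two_chords_time_le a (eps u w v : R) : abs_continuous01 a -> 0 < eps < 1 ->
  (forall s, 0 <= s <= 1 -> eps <= enorm (a s) <= 1) ->
  measurable_fun (`]0, 1[%classic : set R) (time_density a) ->
  0 <= u -> u <= w -> w <= v -> v <= 1 ->
  ((slowness eps * (enorm (a w - a u) + enorm (a v - a w)))%:E <=
   \int[mu]_(s in `]u, v[) time_density a s)%E.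
Proof.
move=> aca e01 a01 ma u0 uw wv v1.
have w0 := le_trans u0 uw; have w1 := le_trans wv v1.
have m01 : measurable (`]0, 1[%classic : set R) by exact: measurable_itv.
have mI x y : measurable (`]x, y[%classic : set R) by exact: measurable_itv.
have sub01 : `]u, v[ `<=` `]0, 1[.
  by move=> x /=; rewrite !in_itv/= => /andP[/(le_lt_trans u0) -> /lt_le_trans ->].
have subI : `]u, w[ `|` `]w, v[ `<=` `]u, v[.
  move=> x /=; rewrite !in_itv/= => -[|] /andP[x1 x2].
    by rewrite x1 (lt_le_trans x2).
  by rewrite x2 (le_lt_trans uw).
have muv : measurable_fun `]u, v[ (time_density a) by exact: (measurable_funS m01 sub01 ma).
have sub : (\int[mu]_(s in `]u, w[ `|` `]w, v[) time_density a s <=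
    \int[mu]_(s in `]u, v[) time_density a s)%E.
  apply: ge0_subset_integral.
  - by apply: measurableU; exact: mI.
  - exact: mI.
  - exact: muv.
  - by move=> s _; exact: time_density_ge0.
  - exact: subI.
apply: le_trans sub; rewrite ge0_integral_setU.
  + rewrite mulrDr EFinD; apply: leeD; exact: chord_time_le.
  + exact: mI.
  + exact: mI.
  + exact: measurable_funS muv.
  + by move=> s _; exact: time_density_ge0.
  + apply/disj_setPS => x [/=]; rewrite !in_itv/= => /andP[_ xw] /andP[wx _].
    by move: (lt_trans xw wx); rewrite ltxx.
Qed.

(** The chord is run at constant speed, its length divided by v - u. *)
Lemma shortcut_time_le a (u v M : R) : M < 1 -> u < v ->
  measurable_fun `]u, v[ (time_density (shortcut a u v)) ->
  (forall l : R, 0 <= l <= 1 -> 0 < enorm (chord (a u) (a v) l) <= M) ->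
  (\int[mu]_(s in `]u, v[) time_density (shortcut a u v) s <=
   (slowness M * enorm (a v - a u))%:E)%E.
Proof.
move=> M1 uv mb ch; have vu : 0 < v - u by rewrite subr_gt0.
apply: (@le_trans _ _ (\int[mu]_(s in `]u, v[) (enorm (a v - a u) / (v - u) * slowness M)%:E)%E); last first.
  rewrite integral_cst/=; last exact: measurable_itv.
  rewrite lebesgue_measure_itv/= lte_fin uv -EFinB -EFinM lee_fin.
  rewrite le_eqVlt; apply/orP; left; apply/eqP; field.
  by rewrite gt_eqF.
apply: ge0_le_integral.
- exact: measurable_itv.
- by move=> s _; exact: time_density_ge0.
- exact: mb.
- by apply/measurable_EFinP; exact: measurable_cst.
move=> s; rewrite /= in_itv/= => suv; have /andP[us sv] := suv.
have l01 : 0 <= (s - u) / (v - u) <= 1.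
  rewrite divr_ge0 ?subr_ge0 ?(ltW us) ?(ltW uv)//=.
  by rewrite ler_pdivrMr// mul1r lerD2r ltW.
have /andP[c0 cM] := ch _ l01.
have E : shortcut a u v s = chord (a u) (a v) ((s - u) / (v - u)) by rewrite /shortcut suv.
rewrite time_densityE E//; last exact: le_lt_trans M1.
rewrite velocity_shortcut_in// lee_fin ler_wpM2l//.
  by rewrite divr_ge0 ?enorm_ge0// ltW.
exact: slowness_le.
Qed.

(** At u and v the one-sided velocities need not agree, so the densities are
    only equal almost everywhere. *)
Lemma shortcut_time_outside a (u v : R) :
  measurable_fun (outside u v) (time_density a) ->
  measurable_fun (outside u v) (time_density (shortcut a u v)) ->
  (\int[mu]_(s in outside u v) time_density (shortcut a u v) s =
   \int[mu]_(s in outside u v) time_density a s)%E.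
Proof.
move=> ma mb; apply: ae_eq_integral.
- by apply: measurableD; exact: measurable_itv.
- exact: mb.
- exact: ma.
exists [set u; v]; split.
- by apply: measurableU; exact: measurable_set1.
- apply: countable_lebesgue_measure0; exact: finite_set_countable.
move=> s /= ns; apply: contrapT => suv; apply: ns => -[/= _]; rewrite in_itv/= => nuv.
apply: density_shortcut_out.
have /not_orP[/eqP su /eqP sv] := suv.
move/negP: nuv; rewrite negb_and -!leNgt !le_eqVlt.
by rewrite (negbTE su) (eq_sym v s) (negbTE sv).
Qed.

Lemma admissible_shortcut eps (B : R * R) a (u v : R) : 0 <= u -> u < v -> v <= 1 ->
  admissible_off eps B a ->
  (forall l : R, 0 <= l <= 1 -> eps <= enorm (chord (a u) (a v) l) <= 1) ->
  admissible_off eps B (shortcut a u v).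
Proof.
move=> u0 uv v1 [[aca a_0 a_1 a_le] a_ge] ch.
have b01 s : 0 <= s <= 1 -> eps <= enorm (shortcut a u v s) <= 1.
  move=> s01; rewrite /shortcut; case: ifP => [/andP[us sv]|_]; last by rewrite a_ge// a_le.
  have vu : 0 < v - u by rewrite subr_gt0.
  apply: ch; rewrite divr_ge0 ?subr_ge0 ?(ltW us) ?(ltW uv)//=.
  by rewrite ler_pdivrMr// mul1r lerD2r ltW.
split; [split|].
- exact: ac_shortcut.
- by rewrite /shortcut ltNge u0.
- by rewrite /shortcut [1 < v]ltNge v1 andbF.
- by move=> s /b01 /andP[].
- by move=> s /b01 /andP[].
Qed.

(** The equation between z and z' is a hypothesis, rather than a rewriting, for
    the same reason as in [no_gain]. *)
Lemma cancel_outside (z z' x y : \bar R) : z' = z ->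
  (0 <= z -> 0 <= x -> z + x < +oo -> z + x <= z' + y -> x <= y)%E.
Proof.
move=> ->.
move: z x => [z| |] [x| |] // z0 x0 _.
by case: y => [y| |] //; rewrite -?EFinD ?lee_fin ?lerD2l ?leey.
Qed.

(** The chord from a u to a v is a competitor, and it only changes the time
    spent between u and v. *)
Lemma chord_inequality eps (B : R * R) a (u w v M : R) : 0 < eps < 1 ->
  minimizer (admissible_off eps B) a -> (time_of_flight a < +oo)%E ->
  0 <= u -> u <= w -> w <= v -> u < v -> v <= 1 -> M < 1 ->
  (forall l : R, 0 <= l <= 1 -> eps <= enorm (chord (a u) (a v) l) <= M) ->
  slowness eps * (enorm (a w - a u) + enorm (a v - a w)) <= slowness M * enorm (a v - a u).
Proof.
move=> e01 [aA aleast] Tfin u0 uw wv uv v1 M1 ch.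
have e0 : 0 < eps by case/andP: e01.
have bA : admissible_off eps B (shortcut a u v).
  apply: admissible_shortcut => // l l01.
  by have /andP[-> /le_trans ->] := ch l l01; rewrite // ltW.
have Tab := aleast _ bA; move: aA bA => [[aca _ _ a_le] a_ge] [[acb _ _ b_le] b_ge].
have ma : measurable_fun (`]0, 1[%classic : set R) (time_density a).
  by apply: measurable_time_density => // s s01; rewrite a_le// (lt_le_trans e0 (a_ge s s01)).
have mb : measurable_fun (`]0, 1[%classic : set R) (time_density (shortcut a u v)).
  by apply: measurable_time_density => // s s01; rewrite b_le// (lt_le_trans e0 (b_ge s s01)).
have a01 s : 0 <= s <= 1 -> eps <= enorm (a s) <= 1 by move=> s01; rewrite a_ge// a_le.
have m01 : measurable (`]0, 1[%classic : set R) by exact: measurable_itv.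
have sub01 : `]u, v[ `<=` `]0, 1[.
  by move=> x /=; rewrite !in_itv/= => /andP[/(le_lt_trans u0) -> /lt_le_trans ->].
have sout : outside u v `<=` `]0, 1[ by exact: subDsetl.
move: Tab Tfin; rewrite (time_of_flight_split u0 (ltW uv) v1 ma) (time_of_flight_split u0 (ltW uv) v1 mb).
have mouta := measurable_funS m01 sout ma.
have moutb := measurable_funS m01 sout mb.
move=> Tab Tfin.
have IJ := cancel_outside (shortcut_time_outside mouta moutb)
  (integral_density_ge0 _ _) (integral_density_ge0 _ _) Tfin Tab.
rewrite -lee_fin; apply: le_trans (two_chords_time_le aca e01 a01 ma u0 uw wv v1) _.
apply: le_trans IJ _; apply: shortcut_time_le.
- exact: M1.
- exact: uv.
- exact: (measurable_funS m01 sub01 mb).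
- by move=> l l01; have /andP[/(lt_le_trans e0) -> ->] := ch l l01.
Qed.

End shortcut.

(** * No corner at the last contact *)

Section corner.
Context {R : realType}.
Implicit Types (p q u v : R * R).

(** The points x with x . u >= eps |u| form a half-plane, bounded by a tangent
    of the circle, that does not meet the open disk. It contains u, and v as
    well: the outward component of v - p is of order delta, the curvature of
    the circle only of order delta^2. *)
Lemma chord_off_obstacle p u v (eps delta beta : R) :
  0 < eps -> 0 < delta -> 3 * delta <= 2 * (beta * eps) ->
  enorm p = eps -> enorm (u - p) = delta -> enorm (v - p) = delta -> eps <= enorm u ->
  beta * eps * delta <= dot (v - p) p ->
  forall l : R, 0 <= l <= 1 -> eps <= enorm (chord u v l) <= eps + delta.
Proof.
move=> e0 d0 db pe ue ve u_ge vp l /andP[l0 l1].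
have Ep := sqr_enorm p; have Eu := sqr_enorm (u - p); have Ev := sqr_enorm (v - p).
have Uu := sqr_enorm u.
rewrite pe in Ep; rewrite ue /= in Eu; rewrite ve /= in Ev.
have UV : - delta ^+ 2 <= dot (u - p) (v - p).
  have := dot_le (- (u - p)) (v - p); have -> : enorm (- (u - p)) = enorm (u - p).
    by rewrite /enorm /dot/= !mulrNN.
  by rewrite ue ve /dot/= !mulNr expr2; lra.
have vu : eps * enorm u <= dot v u.
  have h1 : eps * enorm u <= (eps ^+ 2 + enorm u ^+ 2) / 2.
    by have := sqr_ge0 (eps - enorm u); rewrite sqrrB; lra.
  apply: le_trans h1 _; rewrite Uu.
  move: vp UV; rewrite /dot/= => vp UV; nra.
have uu : eps * enorm u <= dot u u.
  by rewrite /dot -!expr2 -Uu expr2 ler_wpM2r ?enorm_ge0.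
have u0 : 0 < enorm u by exact: lt_le_trans u_ge.
apply/andP; split.
  rewrite -(ler_pM2r u0); apply: le_trans (dot_le _ _).
  have -> : dot (chord u v l) u = (1 - l) * dot u u + l * dot v u by rewrite /dot /chord/=; ring.
  have -> : eps * enorm u = (1 - l) * (eps * enorm u) + l * (eps * enorm u) by ring.
  by apply: lerD; apply: ler_wpM2l => //; lra.
apply: enorm_le; first by rewrite addr_ge0// ltW.
pose w := (1 - l) *: (u - p) + l *: (v - p).
have w_le : w.1 ^+ 2 + w.2 ^+ 2 <= delta ^+ 2.
  have uv_le : dot (u - p) (v - p) <= delta ^+ 2.
    by have := dot_le (u - p) (v - p); rewrite ue ve expr2.
  have -> : w.1 ^+ 2 + w.2 ^+ 2 = (1 - l) ^+ 2 * ((u.1 - p.1) ^+ 2 + (u.2 - p.2) ^+ 2)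
      + l ^+ 2 * ((v.1 - p.1) ^+ 2 + (v.2 - p.2) ^+ 2) + 2 * (l * (1 - l)) * dot (u - p) (v - p).
    by rewrite /w /dot/= /GRing.scale/=; ring.
  rewrite -Eu -Ev.
  have : 2 * (l * (1 - l)) * dot (u - p) (v - p) <= 2 * (l * (1 - l)) * delta ^+ 2.
    by apply: ler_wpM2l => //; rewrite !mulr_ge0//; lra.
  have -> : 2 * (l * (1 - l)) * delta ^+ 2 = delta ^+ 2 - (1 - l) ^+ 2 * delta ^+ 2 - l ^+ 2 * delta ^+ 2 by ring.
  lra.
have pw : dot p w <= eps * delta.
  apply: le_trans (dot_le _ _) _; rewrite pe ler_wpM2l ?(ltW e0)//.
  by apply: enorm_le => //; exact: ltW.
have -> : (chord u v l).1 = p.1 + w.1 by rewrite /w/= /GRing.scale/=; ring.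
have -> : (chord u v l).2 = p.2 + w.2 by rewrite /w/= /GRing.scale/=; ring.
move: w_le pw; rewrite /dot; lra.
Qed.

(** Put U = u - p and V = v - p. Since u is not in the open disk, the radial
    component of U is at least - delta^2 / (2 eps), so that of U + V is at least
    beta delta / 2. By the parallelogram law |v - u|^2 = 4 delta^2 - |U + V|^2,
    which is less than (2 delta)^2 by a factor depending on beta only, while the
    ratio of the slownesses tends to 1 with delta. *)
Lemma chord_faster_than_corner p u v (eps delta beta : R) : 0 < eps < 1 -> 0 < beta <= 1 -> 0 < delta ->
  delta < eps * (1 - eps) * beta ^+ 2 / 16 ->
  enorm p = eps -> enorm (u - p) = delta -> enorm (v - p) = delta -> eps <= enorm u ->
  beta * eps * delta <= dot (v - p) p ->
  slowness (eps + delta) * enorm (v - u) < slowness eps * (delta + delta).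
Proof.
move=> /andP[e0 e1] /andP[b0 b1] d0 dsmall pe ue ve u_ge vp.
have Ep := sqr_enorm p; have Eu := sqr_enorm (u - p); have Ev := sqr_enorm (v - p).
rewrite pe in Ep; rewrite ue /= in Eu; rewrite ve /= in Ev.
have b2 : beta ^+ 2 <= beta by rewrite expr2 ler_piMl// ltW.
have ee : 0 < eps * (1 - eps) by rewrite mulr_gt0// subr_gt0.
have dbe : delta <= beta * eps.
  apply: le_trans (ltW dsmall) _.
  have : eps * (1 - eps) * beta ^+ 2 <= eps * beta.
    apply: ler_pM => //; [exact: ltW|by rewrite sqr_ge0|by rewrite ger_pMr//; lra].
  have : 0 < beta * eps by rewrite mulr_gt0.
  lra.
have d1 : eps + delta < 1.
  have : eps * (1 - eps) * beta ^+ 2 <= 1 - eps.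
    rewrite mulrC mulrA; rewrite ler_piMl ?subr_ge0 ?(ltW e1)//.
    by rewrite mulr_ile1 ?sqr_ge0 ?(ltW e0) ?(ltW e1)// (le_trans b2).
  lra.
have up : - delta ^+ 2 / 2 <= dot (u - p) p.
  have := sqr_enorm u; have : eps ^+ 2 <= enorm u ^+ 2 by rewrite ler_pXn2r ?nnegrE ?enorm_ge0 ?(ltW e0).
  rewrite /dot/=; nra.
have sum_ge : (beta * delta / 2) ^+ 2 <= (u.1 - p.1 + (v.1 - p.1)) ^+ 2 + (u.2 - p.2 + (v.2 - p.2)) ^+ 2.
  pose w := (u - p) + (v - p).
  have wp : beta * eps * delta / 2 <= dot w p.
    have : dot w p = dot (u - p) p + dot (v - p) p by rewrite /dot/=; ring.
    have : delta ^+ 2 <= beta * eps * delta by rewrite expr2 ler_wpM2r// ltW.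
    lra.
  have : beta * delta / 2 <= enorm w.
    rewrite -(ler_pM2r e0) -[X in _ <= _ * X]pe; apply: le_trans (dot_le _ _).
    by apply: le_trans wp; rewrite le_eqVlt; apply/orP; left; apply/eqP; field.
  have bd : 0 <= beta * delta / 2 by rewrite divr_ge0 ?mulr_ge0 ?ltW.
  by rewrite -(@ler_pXn2r _ 2)// ?nnegrE ?enorm_ge0// sqr_enorm.
have vu : enorm (v - u) ^+ 2 <= (4 - beta ^+ 2 / 4) * delta ^+ 2.
  rewrite sqr_enorm /=.
  have -> : (v.1 - u.1) ^+ 2 + (v.2 - u.2) ^+ 2 =
    2 * ((u.1 - p.1) ^+ 2 + (u.2 - p.2) ^+ 2) + 2 * ((v.1 - p.1) ^+ 2 + (v.2 - p.2) ^+ 2)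
    - ((u.1 - p.1 + (v.1 - p.1)) ^+ 2 + (u.2 - p.2 + (v.2 - p.2)) ^+ 2) by ring.
  rewrite -Eu -Ev.
  have -> : (4 - beta ^+ 2 / 4) * delta ^+ 2 = 2 * delta ^+ 2 + 2 * delta ^+ 2 - (beta * delta / 2) ^+ 2 by field.
  lra.
have dd0 : 0 <= delta + delta by rewrite addr_ge0// ltW.
rewrite -(@ltr_pXn2r _ 2)// ?nnegrE ?mulr_ge0 ?slowness_ge0 ?enorm_ge0//.
have ed0 : 0 < eps + delta by rewrite addr_gt0.
rewrite !exprMn !sqr_slowness//.
apply: (@le_lt_trans _ _ ((eps + delta) / (1 - (eps + delta)) * ((4 - beta ^+ 2 / 4) * delta ^+ 2))).
  by rewrite ler_wpM2l// divr_ge0 ?(ltW ed0)// subr_ge0 ltW.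
have -> : (delta + delta) ^+ 2 = 4 * delta ^+ 2 by ring.
rewrite [ltLHS]mulrA [ltRHS]mulrA ltr_pM2r ?exprn_gt0//.
have i1 : 0 < 1 - eps by rewrite subr_gt0.
have i2 : 0 < 1 - (eps + delta) by rewrite subr_gt0.
have -> : (eps + delta) / (1 - (eps + delta)) * (4 - beta ^+ 2 / 4) =
  ((eps + delta) * (4 - beta ^+ 2 / 4)) / (1 - (eps + delta)) by rewrite mulrAC.
rewrite ltr_pdivrMr//.
have -> : eps / (1 - eps) * 4 * (1 - (eps + delta)) = (eps * 4 * (1 - (eps + delta))) / (1 - eps) by ring.
rewrite ltr_pdivlMr//.
have : delta * (1 - eps) * (1 - beta ^+ 2 / 16) <= delta * (1 - eps).
  by rewrite ler_piMr ?mulr_ge0 ?(ltW d0) ?(ltW i1)//; have := sqr_ge0 beta; lra.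
nra.
Qed.

End corner.

Section departure.
Context {R : realType}.
Implicit Types (a : R -> R * R).

Lemma continuous_distance a (p : R * R) : abs_continuous01 a ->
  continuous (fun s => enorm (a (clamp01 s) - p)).
Proof.
move=> aca s.
apply: (@continuous_sqrt_sum _ (fun s => (a (clamp01 s)).1 - p.1) (fun s => (a (clamp01 s)).2 - p.2)).
  by apply: cvgB; [exact: continuous_fst|exact: cvg_cst].
by apply: cvgB; [exact: continuous_snd|exact: cvg_cst].
Qed.

(** Otherwise let u be an earlier point of the curve at the same distance from
    the point of contact: the chord from u to a s is a faster way round the
    corner, by [chord_faster_than_corner], against [chord_inequality]. *)
Lemma secant_not_outward a (eps r s0 s beta : R) : 0 < eps < 1 -> eps <= r <= 1 ->
  minimizer (admissible_off eps (polar r pi)) a ->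
  0 <= s0 -> enorm (a s0) = eps -> s0 < s -> s <= 1 -> 0 < beta <= 1 ->
  0 < enorm (a s - a s0) -> enorm (a s - a s0) < eps * (1 - eps) * beta ^+ 2 / 16 ->
  dot (a s - a s0) (a s0) < beta * eps * enorm (a s - a s0).
Proof.
move=> e01 r01 amin s00 ae ss s1 b01 d0 dsmall; rewrite ltNge; apply/negP => outward.
have Tfin := minimizer_finite e01 r01 amin.
have [[[aca a_0 _ _] a_ge] _] := amin.
have [e0 e1] := andP e01; have [b0 b1] := andP b01.
set delta := enorm (a s - a s0) in d0 dsmall outward.
have s01 : s0 <= 1 by exact: le_trans (ltW ss) s1.
have [b2 bb] : beta ^+ 2 <= beta /\ beta ^+ 2 <= 1.
  by rewrite expr_le1 ?(ltW b0)// expr2 ler_piMl// ltW.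
have k1 : eps * (1 - eps) * beta ^+ 2 <= 1 - eps.
  rewrite mulrC mulrA ler_piMl ?subr_ge0 ?(ltW e1)//.
  by rewrite mulr_ile1 ?sqr_ge0 ?(ltW e0) ?(ltW e1).
have k2 : eps * (1 - eps) * beta ^+ 2 <= beta * eps.
  rewrite mulrAC [leRHS]mulrC; apply: (@le_trans _ _ (eps * beta ^+ 2)).
    by rewrite ler_piMr ?mulr_ge0 ?sqr_ge0 ?(ltW e0)//; lra.
  by rewrite ler_wpM2l// ltW.
have cg := @continuous_distance a (a s0) aca.
have [s1' s1'01 us] : exists2 t, t \in `[0, s0] & enorm (a (clamp01 t) - a s0) = delta.
  apply: (@IVT R (fun t => enorm (a (clamp01 t) - a s0)) 0 s0 delta s00).
    exact: continuous_subspaceT.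
  rewrite !clamp01_id// subrr enorm0 ge_min le_max (ltW d0) orbT/=.
  apply/orP; left; rewrite a_0.
  have h1 : 1 = dot (1, 0 : R) ((1, 0) - a s0) + dot (1, 0) (a s0) by rewrite /dot/=; ring.
  have n1 : enorm (1, 0 : R) = 1 by rewrite /enorm /dot/= mulr1 mulr0 addr0 sqrtr1.
  have := dot_le (1, 0) ((1, 0) - a s0); have := dot_le (1, 0) (a s0).
  rewrite n1 ae !mul1r; lra.
move: s1'01; rewrite in_itv/= => /andP[t0 ts0].
rewrite clamp01_id ?(le_trans ts0)// in us.
have u01 : 0 <= s1' <= 1 by rewrite t0 (le_trans ts0).
have ts : s1' < s by exact: le_lt_trans ss.
have far := @chord_off_obstacle _ (a s0) (a s1') (a s) eps delta beta e0 d0 _ ae us erefl (a_ge _ u01) outward.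
have h3 : 3 * delta <= 2 * (beta * eps) by have := mulr_gt0 b0 e0; lra.
have d1 : eps + delta < 1 by lra.
have := chord_inequality e01 amin Tfin t0 ts0 (ltW ss) ts s1 d1 (far h3).
have := chord_faster_than_corner e01 b01 d0 dsmall ae us erefl (a_ge _ u01) outward.
have -> : enorm (a s0 - a s1') = delta.
  by rewrite -us -[a s0 - _]opprB /enorm /dot/= !mulrNN.
by rewrite -/delta => /lt_le_trans h /h; rewrite ltxx.
Qed.

Lemma last_contact_exists a (eps r : R) : 0 < eps < 1 -> eps <= r <= 1 ->
  minimizer (admissible_off eps (polar r pi)) a ->
  exists s0, last_contact eps a s0.
Proof.
move=> e01 r01 amin; have [s s01 se] := contact_exists e01 r01 amin.
have [[[aca _ _ _] a_ge] _] := amin; have [s0 s1] := andP s01.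
have [|t [st t1 te tlast]] := last_time_le (c := eps) (continuous_enorm aca) s1.
  by rewrite clamp01_id// se.
have t0 := le_trans s0 st; have t01 : 0 <= t <= 1 by rewrite t0.
exists t; split => //.
  by apply/eqP; rewrite eq_le a_ge// andbT -[t]clamp01_id.
move=> s' /andP[ts' s'1]; rewrite gt_eqF//.
by have := tlast s' ts' s'1; rewrite clamp01_id// (le_trans t0)// ltW.
Qed.

Lemma same_sign (h : R -> R) (x y : R) : continuous h -> x <= y ->
  (forall z, x <= z -> z <= y -> h z != 0) -> 0 < h x * h y.
Proof.
move=> ch xy h0.
have noz : (h x < 0 /\ 0 < h y) \/ (0 < h x /\ h y < 0) -> False.
  move=> H; have [|z] := @IVT R h x y 0 xy (continuous_subspaceT ch).
    by rewrite ge_min le_max; case: H => -[/ltW -> /ltW ->]; rewrite ?orbT.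
  rewrite in_itv/= => /andP[xz zy] /eqP.
  by rewrite (negbTE (h0 z xz zy)).
have hx0 := h0 x (lexx x) xy; have hy0 := h0 y xy (lexx y).
case: (ltgtP (h x) 0) hx0 => // hx _; case: (ltgtP (h y) 0) hy0 => // hy _.
- by rewrite nmulr_lgt0.
- by exfalso; apply: noz; left.
- by exfalso; apply: noz; right.
- by rewrite mulr_gt0.
Qed.

(** Let N and T be the radial and tangential components of the unit secant at
    the last contact p. By [secant_not_outward] the upper limit of N is at most
    0; as the curve stays outside the disk, N >= - |a s - p| / (2 eps), so N
    tends to 0 and T^2 to 1. Then T does not vanish near s0, hence has a constant sign sg,
    and the secants tend to sg times the unit tangent vector. *)
Lemma tangential_departure a (eps r s0 : R) : 0 < eps < 1 -> eps <= r <= 1 ->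
  minimizer (admissible_off eps (polar r pi)) a ->
  last_contact eps a s0 -> s0 < 1 -> departs_tangentially a s0.
Proof.
move=> e01 r01 amin [s001 pe slast] s1.
have [[[aca _ _ _] a_ge] _] := amin; have [s00 _] := andP s001.
have [e0 e1] := andP e01.
set p := a s0 in pe *.
pose dl s := enorm (a s - p).
have dl_gt0 s : s0 < s -> s <= 1 -> 0 < dl s.
  move=> ss s1'; rewrite lt_neqAle enorm_ge0 andbT eq_sym; apply/eqP => /enorm_eq0/subr0_eq sp.
  by have := slast s; rewrite ss s1' sp pe eqxx => /(_ isT).
pose N s := dot (a s - p) p / (eps * dl s).
pose T s := dot (a s - p) (- p.2, p.1) / (eps * dl s).
have dlsmall (e : R) : 0 < e -> \forall s \near s0^'+, dl s < e.
  move=> ep; have /cvgrPdist_lt/(_ _ ep) := @continuous_distance a p aca s0.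
  rewrite clamp01_id ?(ltW s1)// subrr enorm0 => h.
  near=> s.
  have ss : s0 < s by near: s; exact: nbhs_right_gt.
  have s1' : s <= 1 by near: s; exact: nbhs_right_le.
  have : `|0 - enorm (a (clamp01 s) - p)| < e by near: s; exact: cvg_within h.
  by rewrite sub0r normrN ger0_norm ?enorm_ge0// clamp01_id// (le_trans s00 (ltW ss)).
have Nsmall (e : R) : 0 < e -> e <= 1 -> \forall s \near s0^'+, `|N s| <= e.
  move=> ep e_le1; near=> s.
  have ss : s0 < s by near: s; exact: nbhs_right_gt.
  have s1' : s <= 1 by near: s; exact: nbhs_right_le.
  have d0 := dl_gt0 s ss s1'.
  have ed0 : 0 < eps * dl s by rewrite mulr_gt0.
  have d1 : dl s < eps * (1 - eps) * e ^+ 2 / 16.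
    by near: s; apply: dlsmall; rewrite divr_gt0// !mulr_gt0 ?exprn_gt0// subr_gt0.
  have d2 : dl s < eps * e by near: s; apply: dlsmall; rewrite mulr_gt0.
  have b01 : 0 < e <= 1 by rewrite ep.
  have up := secant_not_outward e01 r01 amin s00 pe ss s1' b01 d0 d1.
  have lo : - dl s ^+ 2 / 2 <= dot (a s - p) p.
    have ps := sqr_enorm (a s); have pp := sqr_enorm p; have pd := sqr_enorm (a s - p).
    have s01 : 0 <= s <= 1 by rewrite s1' (le_trans s00 (ltW ss)).
    have : eps ^+ 2 <= enorm (a s) ^+ 2 by rewrite ler_pXn2r ?nnegrE ?enorm_ge0 ?(ltW e0)// a_ge.
    rewrite ps -pe pp /dl pd /dot/=; lra.
  rewrite /N ler_norml ler_pdivlMr// ler_pdivrMr//; apply/andP; split; last first.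
    by rewrite mulrA ltW.
  apply: le_trans lo.
  have : dl s * dl s <= eps * e * dl s by rewrite ler_wpM2r// ltW.
  have := mulr_gt0 ep ed0; rewrite expr2; lra.
have NT s : s0 < s -> s <= 1 -> N s ^+ 2 + T s ^+ 2 = 1.
  move=> ss s1'; have d0 := dl_gt0 s ss s1'.
  have pp := sqr_enorm p; have pd := sqr_enorm (a s - p).
  rewrite pe in pp; rewrite -/(dl s) in pd.
  rewrite /N /T !expr_div_n -mulrDl exprMn pp pd.
  have -> : dot (a s - p) p ^+ 2 + dot (a s - p) (- p.2, p.1) ^+ 2 =
     (p.1 ^+ 2 + p.2 ^+ 2) * ((a s - p).1 ^+ 2 + (a s - p).2 ^+ 2).
    by rewrite /dot/=; ring.
  by rewrite divff// -pp -pd gt_eqF// mulr_gt0// exprn_gt0.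
have Nhalf : \forall s \near s0^'+, `|N s| <= 2^-1 by apply: Nsmall; lra.
have [eta /= eta0 Neta] : exists2 eta : R, 0 < eta &
    forall s, s0 < s -> s < s0 + eta -> s <= 1 /\ `|N s| <= 2^-1.
  have : \forall s \near s0^'+, s <= 1 /\ `|N s| <= 2^-1.
    by apply: filterI => //; exact: nbhs_right_le.
  move=> /nbhs_ballP[eta /= eta0 H]; exists eta => // s ss se.
  apply: H => //=; rewrite /ball/= distrC ger0_norm ?subr_ge0 ?(ltW ss)//; lra.
pose h s := dot (a (clamp01 s) - p) (- p.2, p.1).
have ch : continuous h.
  move=> s; apply: cvgD.
    by apply: cvgM; [apply: cvgB; [exact: continuous_fst|exact: cvg_cst]|exact: cvg_cst].
  by apply: cvgM; [apply: cvgB; [exact: continuous_snd|exact: cvg_cst]|exact: cvg_cst].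
have hT s : s0 < s -> s <= 1 -> h s = T s * (eps * dl s).
  move=> ss s1'; rewrite /T divfK ?gt_eqF ?mulr_gt0 ?dl_gt0//.
  by rewrite /h clamp01_id// (le_trans s00 (ltW ss)).
have h_neq0 s : s0 < s -> s < s0 + eta -> h s != 0.
  move=> ss se; have [s1' Ns] := Neta s ss se.
  rewrite hT// mulf_neq0//; last by rewrite gt_eqF ?mulr_gt0 ?dl_gt0.
  apply/eqP => T0; have := NT s ss s1'; rewrite T0 expr0n/= addr0 => N1.
  have : N s ^+ 2 <= 2^-1 ^+ 2.
    by rewrite -[X in X <= _]ger0_norm ?sqr_ge0// normrX ler_pXn2r ?nnegrE.
  rewrite N1; lra.
pose sm := s0 + eta / 2.
have sm0 : s0 < sm by rewrite /sm; lra.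
have sme : sm < s0 + eta by rewrite /sm; lra.
pose sg := Num.sg (h sm).
have sg2 : sg ^+ 2 = 1 by rewrite /sg sqr_sg h_neq0.
have Tsg s : s0 < s -> s < s0 + eta -> 0 < sg * T s.
  move=> ss se; have [s1' _] := Neta s ss se.
  have ed0 : 0 < eps * dl s by rewrite mulr_gt0 ?dl_gt0.
  rewrite -(pmulr_lgt0 _ ed0) -mulrA -hT//.
  have : 0 < h sm * h s.
    have [sms|ssm] := leP sm s.
      by apply: same_sign => // z z1 z2; apply: h_neq0; lra.
    rewrite mulrC; apply: same_sign => //; first exact: ltW.
    by move=> z z1 z2; apply: h_neq0; lra.
  have hm := h_neq0 sm sm0 sme.
  rewrite /sg; case: (ltgtP (h sm) 0) hm => // hm _ hh.
    by rewrite (ltr0_sg hm) mulN1r oppr_gt0; move: hh; rewrite nmulr_rgt0.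
  by rewrite (gtr0_sg hm) mul1r; move: hh; rewrite pmulr_rgt0.
have Ncvg : N s @[s --> s0^'+] --> (0 : R).
  apply/cvgrPdist_le => e ep.
  have m0 : 0 < Num.min e 1 by rewrite lt_min ep ltr01.
  near=> s; rewrite sub0r normrN.
  apply: (@le_trans _ _ (Num.min e 1)); last by rewrite ge_min lexx.
  by near: s; apply: (Nsmall _ m0); rewrite ge_min lexx orbT.
have Tcvg : T s @[s --> s0^'+] --> sg.
  have : sg * Num.sqrt (1 - N s * N s) @[s --> s0^'+] --> sg * Num.sqrt (1 - 0 * 0).
    apply: cvgM; first exact: cvg_cst.
    apply: (@cvg_comp _ _ _ (fun s => 1 - N s * N s) Num.sqrt _ (nbhs (1 - 0 * 0 : R))); last exact: sqrt_continuous.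
    by apply: cvgB; [exact: cvg_cst|exact: cvgM].
  rewrite mul0r subr0 sqrtr1 mulr1; apply: cvg_trans.
  apply: near_eq_cvg; near=> s.
  have ss : s0 < s by near: s; exact: nbhs_right_gt.
  have se : s < s0 + eta by near: s; apply: nbhs_right_lt; lra.
  have [s1' _] := Neta s ss se.
  have -> : 1 - N s * N s = T s ^+ 2 by rewrite -(NT s ss s1'); ring.
  have -> : T s ^+ 2 = (sg * T s) ^+ 2 by rewrite (exprMn 2 sg) sg2 mul1r.
  rewrite sqrtr_sqr gtr0_norm; last exact: Tsg.
  by rewrite mulrA -expr2 sg2 mul1r.
have pp := sqr_enorm p; rewrite pe in pp.
exists (sg * (- p.2 / eps), sg * (p.1 / eps)); split.
- rewrite /enorm /dot/=.
  have -> : sg * (- p.2 / eps) * (sg * (- p.2 / eps)) + sg * (p.1 / eps) * (sg * (p.1 / eps)) =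
    sg ^+ 2 * ((p.1 ^+ 2 + p.2 ^+ 2) / eps ^+ 2) by field; rewrite gt_eqF.
  by rewrite -pp divff ?gt_eqF ?exprn_gt0// sg2 mulr1 sqrtr1.
- by rewrite /dot/=; ring.
have -> : (sg * (- p.2 / eps), sg * (p.1 / eps)) =
  (0 * (p.1 / eps) + sg * (- p.2 / eps), 0 * (p.2 / eps) + sg * (p.1 / eps)).
  by rewrite !mul0r !add0r.
have C : (N s * (p.1 / eps) + T s * (- p.2 / eps),
          N s * (p.2 / eps) + T s * (p.1 / eps)) @[s --> s0^'+] -->
    (0 * (p.1 / eps) + sg * (- p.2 / eps), 0 * (p.2 / eps) + sg * (p.1 / eps)).
  apply: (@cvg_pair _ _ _ _ (nbhs (0 * (p.1 / eps) + sg * (- p.2 / eps)))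
    (nbhs (0 * (p.2 / eps) + sg * (p.1 / eps))));
    apply: cvgD; apply: cvgM => //; exact: cvg_cst.
apply: cvg_trans C; apply: near_eq_cvg; near=> s.
have ss : s0 < s by near: s; exact: nbhs_right_gt.
have s1' : s <= 1 by near: s; exact: nbhs_right_le.
have d0 := dl_gt0 s ss s1'.
have dn : dl s != 0 by rewrite gt_eqF.
have en : eps != 0 by rewrite gt_eqF.
have E x : x = x * (p.1 ^+ 2 + p.2 ^+ 2) / eps ^+ 2.
  by rewrite -pp mulfK// expf_neq0.
rewrite [RHS]surjective_pairing /= /GRing.scale/= -/(dl s) /N /T /dot/=; congr pair.
  by rewrite [RHS]E; field; rewrite dn en.
by rewrite [RHS]E; field; rewrite dn en.
Unshelve. all: by end_near. Qed.

End departure.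

Theorem proposition8 (R : realType)
  (strong_min : forall D : R, 0 < D ->
     minimizer (admissible (strong_curve D 1)) (strong_curve D) /\
     minimizer (admissible (strong_curve_neg D 1)) (strong_curve_neg D))
  (eps : R) (heps : 0 < eps < 1)
  (r : R) (hr : eps <= r <= 1)
  (a : R -> R * R)
  (a_min : minimizer (admissible_off eps (polar r pi)) a) :
  leaves_at_tangent eps a.
Proof.
have [s0 s0P] := last_contact_exists heps hr a_min.
by exists s0; split => // s1; exact: (tangential_departure heps hr a_min s0P s1).
Qed.
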